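(* Let $K,f,\Gamma_w,U$ be as in the context. Let $r$ be any positive number with $r<R_f$, and assume there is a continuous deformation $\overline\Gamma_w$ of $\Gamma_w$ with the properties listed in the context (for this $r$), in particular $\rho_w>0$ for all $w\in W$. Then for $-n_0\le n<k_0-1$ and all $(w,\gamma)\in W\times(U\cap D(0,r))$, $$\left|A^\gamma_{K,\Gamma}(f)(w)-\tilde A^{\gamma,n}_{K,\Gamma}(f)(w)\right|\le\overline C_n(r,\rho_w)\,c_w\,\tilde c_\gamma\,|\gamma|^{n+1}\,\delta^{-1},$$ where $$\overline C_n(r,\rho_w)=\frac{d\,c\,r^{-n_0}+d\,\max\left(r^{-n_0},\rho_w^{\,n-k_0+1}\right)\kappa(r)}{b\,r^{n+1}} .$$
   Context: Setting. For a meromorphic function $h$ on $\mathbb C$, $P_h$ denotes its set of poles and $h_\gamma(z)=h(\gamma z)$. $D(0,R)$ is the open disc of radius $R$ about $0$. $W\subset\mathbb C$ is open and connected; $K$ is a meromorphic function on $W\times\mathbb C$ such that for every $w\in W$ the set $\{w\}\times\mathbb C$ is not contained in its pole divisor; $K_w(z)=K(w,z)$. $(\Gamma_w)_{w\in W}$ is a continuous family of curves in $\mathbb C$ (possibly non-compact, possibly with fixed boundary) with $\Gamma_w\subset\mathbb C\setminus P_{K_w}$. $U\subset\mathbb C$ is a non-empty connected open set with $0\in\bar U\setminus U$. $f$ is meromorphic on $\mathbb C$ such that $\Gamma_w\subset\mathbb C\setminus(P_{K_w}\cup P_{f_\gamma})$ and $A^\gamma_{K,\Gamma}(f)(w)=\int_{\Gamma_w}K(w,z)f_\gamma(z)\,dz$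 exists for all $(w,\gamma)\in W\times U$. The integrals $h_m(w)=\int_{\Gamma_w}K(w,z)z^m\,dz$ ($m\in\mathbb Z$) are assumed to exist and be holomorphic on $W$. The pole order $k_0\in\mathbb Z_{\ge0}$ of $K_w$ at $0$ is independent of $w$. $n_0\in\mathbb Z_{\ge0}$ is the pole order of $f$ at $0$, $f(z)=\sum_{m=-n_0}^\infty a_mz^m$ is its Laurent series for $0<|z|<R_f$, with $R_f\in(0,\infty]$ the distance from $0$ to $P_f\setminus\{0\}$. $\kappa(r)=\sum_{m=-n_0}^\infty|a_m|r^m$ for $r\in(0,R_f)$, and $\tilde A^{\gamma,n}_{K,\Gamma}(f)(w)=\sum_{m=-n_0}^na_mh_m(w)\gamma^m$. Assumptions on $\overline\Gamma_w$. $\overline\Gamma_w$, $w\in W$, is a continuous deformation of $\Gamma_w$ consisting of $d$ (finitely many) smooth arc segments, with $\overline\Gamma_w\subset\mathbb C\setminus(P_{K_w}\cup P_{f_\gamma})$ for all $(w,\gamma)\in W\times(U\cap D(0,r))$. There are positive constants $b,c,\delta_1,\delta_2$ with $\delta:=\delta_1-\delta_2>0$, and $c_w\in\mathbb R_+$, $\tilde c_\gamma\in[c,\infty)$ such that for all $w\in W$, $\gamma\in U$ and $z\in\overline\Gamma_w\setminus\{0\}$: $|\cos\Theta(z)|\ge b$, where $\Theta(z)$ is the angle between the line through $0$ and $z$ and the tangent line to the smooth segment of $\overline\Gamma_w$ at $z$; $|K(w,z)|\le c_we^{-\delta_1|z|}|z|^{-k_0}$; $|f_\gamma(z)|\le\tilde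 c_\gamma e^{\delta_2|z|}|\gamma z|^{-n_0}$. Finally $\rho_w=\inf\{|z|:z\in\overline\Gamma_w\}$ is assumed positive for all $w\in W$.
   Formalization: The printed bound fails for small c<1: it is proved for c≥1, and for every c>0 with c̃_γ/c replacing c̃_γ. At non-compact ends the deformation must have piecewise C¹ transversals along which the integrals of K_w f_γ and K_w z^m (−n_0≤m<k_0−1) tend to 0. *)

(* Defs.v *)
(* Stdlib reals with Coquelicot. *)
From Stdlib Require Export Reals ZArith.
From Coquelicot Require Export Coquelicot.

Open Scope R_scope.

Definition Cpowz (z : C) (m : Z) : C :=
  match m with
  | Z0 => RtoC 1
  | Zpos p => Cpow z (Pos.to_nat p)
  | Zneg p => Cinv (Cpow z (Pos.to_nat p))
  end.

Definition dilate (gamma : C) (h : C -> C) : C -> C :=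
  fun z => h (Cmult gamma z).

Definition connected_set {T : UniformSpace} (D : T -> Prop) : Prop :=
  forall A B : T -> Prop, open A -> open B ->
    (forall x, D x -> A x \/ B x) ->
    (forall x, D x -> ~ (A x /\ B x)) ->
    (forall x, D x -> A x) \/ (forall x, D x -> B x).

Definition closure_of {T : UniformSpace} (D : T -> Prop) (x : T) : Prop :=
  forall N : T -> Prop, locally x N -> exists y, N y /\ D y.

Definition holomorphic_at (f : C -> C) (z : C) : Prop :=
  locally z (fun u : C => ex_derive (K := C_AbsRing) (V := C_NormedModule) f u).

Definition C2_NormedModule : NormedModule C_AbsRing :=
  prod_NormedModule C_AbsRing C_NormedModule C_NormedModule.

Definition holomorphic2_at (F : C * C -> C) (p : C * C) : Prop :=
  locally (T := C2_NormedModule) p (fun q : C2_NormedModule =>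
    ex_filterdiff (K := C_AbsRing) (U := C2_NormedModule) (V := C_NormedModule)
      F (locally q)).

(* A meromorphic function is represented by a total function: it is required to
   be holomorphic at every point that is not a pole, so removable singularities
   are filled in, and its value at a pole carries no information. *)
Definition pole_order (f : C -> C) (z0 : C) (k : nat) : Prop :=
  match k with
  | O => holomorphic_at f z0
  | S _ => exists g : C -> C,
      holomorphic_at g z0 /\ g z0 <> RtoC 0 /\
      locally' z0 (fun z : C => f z = Cdiv (g z) (Cpow (Cminus z z0) k))
  end.

Definition is_pole (f : C -> C) (z : C) : Prop :=
  exists k : nat, (0 < k)%nat /\ pole_order f z k.

Definition meromorphic (f : C -> C) : Prop :=
  forall z : C, exists k : nat, pole_order f z k.

(* Locally a quotient of holomorphic functions of two variables, with a
   denominator that vanishes on no non-empty open set. *)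
Definition meromorphic2_on (W : C -> Prop) (K : C -> C -> C) : Prop :=
  forall w z : C, W w ->
    exists G H : C * C -> C,
      holomorphic2_at G (w, z) /\ holomorphic2_at H (w, z) /\
      locally (T := C2_NormedModule) (w, z)
        (fun p : C2_NormedModule =>
           ~ locally p (fun q : C2_NormedModule => H q = RtoC 0)) /\
      locally (T := C2_NormedModule) (w, z)
        (fun p : C2_NormedModule =>
           H p <> RtoC 0 -> K (fst p) (snd p) = Cdiv (G p) (H p)).

Definition pole_divisor (K : C -> C -> C) (w z : C) : Prop :=
  ~ holomorphic2_at (fun p : C * C => K (fst p) (snd p)) (w, z).

(* A curve is a map on the real points t of [ta, tb].  A finite end of the
   parameter interval is a boundary point of the curve (unless the curve is a
   loop); an infinite end is a non-compact end. *)
Definition in_dom (ta tb : Rbar) (t : R) : Prop :=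
  Rbar_le ta (Finite t) /\ Rbar_le (Finite t) tb.

Definition on_curve (G : R -> C) (ta tb : Rbar) (z : C) : Prop :=
  exists t : R, in_dom ta tb t /\ G t = z.

Definition fixed_boundary {T : Type} (S : T -> Prop) (G : T -> R -> C)
    (ta tb : Rbar) : Prop :=
  forall e : R, Finite e = ta \/ Finite e = tb ->
    forall x y : T, S x -> S y -> G x e = G y e.

Definition closed_curves {T : Type} (S : T -> Prop) (G : T -> R -> C)
    (ta tb : Rbar) : Prop :=
  exists u v : R, ta = Finite u /\ tb = Finite v /\
    forall x : T, S x -> G x u = G x v.

Definition continuous_family {T : UniformSpace} (S : T -> Prop) (G : T -> R -> C)
    (ta tb : Rbar) : Prop :=
  continuous_on (T := prod_UniformSpace T R_UniformSpace) (U := C_UniformSpace)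
    (fun p => S (fst p) /\ in_dom ta tb (snd p)) (fun p => G (fst p) (snd p)) /\
  (fixed_boundary S G ta tb \/ closed_curves S G ta tb).

(* D is the derivative of G on the real points of [p, q], one-sided at finite
   ends. *)
Definition C1_arc (G : R -> C) (p q : Rbar) (D : R -> C) : Prop :=
  continuous_on (T := R_UniformSpace) (U := C_UniformSpace) (in_dom p q) G /\
  continuous_on (T := R_UniformSpace) (U := C_UniformSpace) (in_dom p q) D /\
  forall t : R, Rbar_lt p (Finite t) -> Rbar_lt (Finite t) q ->
    is_derive (K := R_AbsRing) (V := C_R_NormedModule) G t (D t).

Definition arc_decomposition (G : R -> C) (ta tb : Rbar) (d : nat)
    (p : nat -> Rbar) (D : nat -> R -> C) : Prop :=
  p O = ta /\ p d = tb /\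
  forall i : nat, (i < d)%nat ->
    Rbar_lt (p i) (p (S i)) /\ C1_arc G (p i) (p (S i)) (D i).

Definition smooth_arcs (G : R -> C) (ta tb : Rbar) (d : nat)
    (p : nat -> Rbar) (D : nat -> R -> C) : Prop :=
  arc_decomposition G ta tb d p D /\
  forall (i : nat) (t : R), (i < d)%nat -> in_dom (p i) (p (S i)) t ->
    D i t <> RtoC 0.

Definition piecewise_C1 (G : R -> C) (ta tb : Rbar) : Prop :=
  forall u v : R, in_dom ta tb u -> in_dom ta tb v -> u < v ->
    exists (d : nat) (p : nat -> Rbar) (D : nat -> R -> C),
      arc_decomposition G (Finite u) (Finite v) d p D.

(* Agrees with the derivative except at the break points, which do not affect
   Riemann integrals. *)
Definition velocity (G : R -> C) (t : R) : C :=
  (Derive (fun s => fst (G s)) t, Derive (fun s => snd (G s)) t).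

Definition end_filter (e : Rbar) : (R -> Prop) -> Prop :=
  match e with
  | Finite t => at_point t
  | _ => Rbar_locally e
  end.

Definition ex_contour_int (g : C -> C) (G : R -> C) (ta tb : Rbar) : Prop :=
  ex_RInt_gen (V := C_R_NormedModule)
    (fun t => Cmult (g (G t)) (velocity G t)) (end_filter ta) (end_filter tb).

(* Improper (possibly only conditionally convergent) at non-compact ends. *)
Definition contour_int (g : C -> C) (G : R -> C) (ta tb : Rbar) : C :=
  RInt_gen (V := C_R_CompleteNormedModule)
    (fun t => Cmult (g (G t)) (velocity G t)) (end_filter ta) (end_filter tb).

(* Deformation inside Omega, with fixed boundary or through loops. *)
Definition deformation (Omega : C -> Prop) (ta tb : Rbar) (G0 G1 : R -> C)
    (H : R -> R -> C) : Prop :=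
  (forall t : R, in_dom ta tb t -> H 0 t = G0 t /\ H 1 t = G1 t) /\
  continuous_family (T := R_UniformSpace) (fun s => 0 <= s <= 1) H ta tb /\
  (forall s t : R, 0 <= s <= 1 -> in_dom ta tb t -> Omega (H s t)).

(* At a non-compact end a homotopy alone does not preserve contour integrals:
   the integral of g over the transversal s |-> H s t, which joins the truncated
   curves, has to tend to 0.  (The rays [0, oo) and the path from 0 to 2 i PI
   followed by 2 i PI + [0, oo) are homotopic in the plane, but the integrals of
   the entire function exp (- exp z) over them are different.) *)
Definition negligible_end (g : C -> C) (H : R -> R -> C) (e : Rbar) : Prop :=
  match e with
  | Finite _ => True
  | _ =>
      Rbar_locally e
        (fun t => piecewise_C1 (fun s => H s t) (Finite 0) (Finite 1)) /\
      filterlim (fun t => contour_int g (fun s => H s t) (Finite 0) (Finite 1))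
        (Rbar_locally e) (locally (T := C_UniformSpace) (RtoC 0))
  end.

(* The angle in [0, PI / 2] between the lines spanned by two non-zero complex
   numbers. *)
Definition line_angle (u v : C) : R :=
  acos (Rabs (Re (Cmult u (Cconj v))) / (Cmod u * Cmod v)).

Definition curve_dist0 (G : R -> C) (ta tb : Rbar) : R :=
  real (Glb_Rbar (fun x => exists z : C, on_curve G ta tb z /\ x = Cmod z)).

Definition pole_dist0 (f : C -> C) : Rbar :=
  Glb_Rbar (fun x => exists z : C, is_pole f z /\ z <> RtoC 0 /\ x = Cmod z).

Definition idx (n0 k : nat) : Z := (Z.of_nat k - Z.of_nat n0)%Z.

Definition laurent_at_0 (f : C -> C) (n0 : nat) (a : Z -> C) : Prop :=
  forall z : C, z <> RtoC 0 -> Rbar_lt (Finite (Cmod z)) (pole_dist0 f) ->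
    is_series (K := C_AbsRing) (V := C_NormedModule)
      (fun k => Cmult (a (idx n0 k)) (Cpowz z (idx n0 k))) (f z).

Definition kappa (n0 : nat) (a : Z -> C) (r : R) : R :=
  Series (fun k => Cmod (a (idx n0 k)) * powerRZ r (idx n0 k)).

Definition transform (K : C -> C -> C) (Gam : C -> R -> C) (ta tb : Rbar)
    (f : C -> C) (gamma w : C) : C :=
  contour_int (fun z => Cmult (K w z) (dilate gamma f z)) (Gam w) ta tb.

Definition moment (K : C -> C -> C) (Gam : C -> R -> C) (ta tb : Rbar)
    (m : Z) (w : C) : C :=
  contour_int (fun z => Cmult (K w z) (Cpowz z m)) (Gam w) ta tb.

(* The index k = 0, ..., n + n0 stands for m = k - n0 = - n0, ..., n. *)
Definition truncated (K : C -> C -> C) (Gam : C -> R -> C) (ta tb : Rbar)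
    (n0 : nat) (a : Z -> C) (n : Z) (gamma w : C) : C :=
  sum_n (G := C_AbelianMonoid)
    (fun k => Cmult (Cmult (a (idx n0 k)) (moment K Gam ta tb (idx n0 k) w))
                    (Cpowz gamma (idx n0 k)))
    (Z.to_nat (n + Z.of_nat n0)).

Definition Cbar (d n0 k0 : nat) (a : Z -> C) (b c : R) (n : Z) (r rho : R) : R :=
  (INR d * c * powerRZ r (- Z.of_nat n0)
   + INR d * Rmax (powerRZ r (- Z.of_nat n0)) (powerRZ rho (n - Z.of_nat k0 + 1))
     * kappa n0 a r)
  / (b * powerRZ r (n + 1)).

(* Main.v *)
Require Import Defs.
From Stdlib Require Import Lra Lia Psatz Classical ClassicalEpsilon.

(** By Cauchy's theorem both the transform and the moments [h_m], [m < k0 - 1],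
    may be computed on the deformed curve, so the error is the integral of
    [K(w,z) (f(gamma z) - sum_(m <= n) a_m (gamma z)^m)] over it.  If
    [|gamma z| <= r], the Laurent remainder is at most
    [(|gamma z| / r)^(n+1) kappa(r)].  If [|gamma z| >= r], the partial sum
    obeys the same bound and [f(gamma z)] is bounded by assumption; here
    [|z| > 1] because [|gamma| < r], which is why no power of [rho_w] multiplies
    the term coming from [f].  As [n + 1 < k0], the remaining power
    [|z|^(n+1-k0)] is at most [rho_w^(n+1-k0)], which leaves
    [exp (- delta |z|)] to integrate.  By the angle condition [|z|] is monotone
    on each of the [d] arcs with [|dz| <= d|z| / b], so each arc contributes at
    most [1 / (b delta)].

    Holomorphic means differentiable near a point, and the homotopy is only
    continuous.  Goursat's lemma makes segment integrals path-independent inside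
    a disc; on a grid so fine that the image of every cell lies in a disc of
    holomorphy, the segment integrals around the cells cancel, and the four
    sides of the rectangle remain. *)

(** Why the conclusion has two bounds: scaling [f] by [s > 0] scales the error, [kappa], [c] and
    [ct] by [s], hence the printed [Cbar * ct] by [s ^ 2]; whenever the error is nonzero, a small
    [s] breaks that bound. The estimate of the integrand produces [ct * r^(-n0) + max(...) * kappa],
    where [kappa] carries no factor [ct]. Since [1 <= ct / c], this is at most [ct / c] times the
    numerator of [Cbar], up to the factor [d], which gives a homogeneous bound; the printed one
    follows when [1 <= c].

    The given integrals are improper and may converge only conditionally. Deformation and estimate
    are therefore carried out on compact parameter intervals [[u, v]], and only the results pass to
    the limit. The intermediate curves of a homotopy have no velocity, so the sides of a rectangle
    are represented by grid sums, which turn into integrals only where a side is known to be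
    piecewise smooth. *)

Local Notation is_RIntC := (is_RInt (V := C_R_NormedModule)).
Local Notation RIntC := (RInt (V := C_R_CompleteNormedModule)).

(** * Complex differentiability *)

Lemma C_R_norm (z : C) : norm (z : C_R_NormedModule) = Cmod z.
Proof.
  unfold norm; simpl; unfold prod_norm, norm; simpl; unfold abs; simpl.
  unfold Cmod; rewrite !Rmult_1_r, <- !Rabs_mult, !Rabs_pos_eq; simpl;
    [now rewrite !Rmult_1_r | nra | nra].
Qed.

Lemma C_R_scal (k : R) (z : C) :
  scal (V := C_R_NormedModule) k z = Cmult (RtoC k) z.
Proof.
  destruct z; unfold scal; simpl; unfold prod_scal, scal; simpl.
  unfold mult; simpl; unfold Cmult; simpl; f_equal; ring.
Qed.

(** The balls of the product uniform structure are squares, but squares and discs generate the same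
    neighbourhoods. *)
Lemma locally_Cmod (z : C) (P : C -> Prop) :
  locally (T := C_UniformSpace) z P <->
  exists del, 0 < del /\ forall u, Cmod (u - z) < del -> P u.
Proof.
  rewrite locally_C; split.
  - intros [eps H]; exists eps; split; [apply cond_pos | exact H].
  - intros (del & Hdel & H); exists (mkposreal del Hdel); exact H.
Qed.

Lemma filterlim_Cmod {T : Type} (F : (T -> Prop) -> Prop) {FF : Filter F}
    (f : T -> C) (l : C) :
  filterlim f F (locally (T := C_UniformSpace) l) <->
  forall eps, 0 < eps -> F (fun x => Cmod (f x - l) < eps).
Proof.
  split.
  - intros H eps Heps; apply (H (fun u => Cmod (u - l) < eps)).
    apply locally_Cmod; exists eps; auto.
  - intros H P HP; apply locally_Cmod in HP as (del & Hdel & HP).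
    apply (filter_imp _ _ (fun x => HP (f x)) (H del Hdel)).
Qed.

Lemma Cmod_sub_sym (x y : C) : Cmod (x - y) = Cmod (y - x).
Proof. rewrite <- Cmod_opp; f_equal; ring. Qed.

Lemma Cminus_neq_0 (x y : C) : x <> y -> (x - y)%C <> RtoC 0.
Proof.
  intros H E; apply H; replace x with (x - y + y)%C by ring; rewrite E; ring.
Qed.

Lemma Cmod_sub_triangle (x y z : C) :
  Cmod (x - z) <= Cmod (x - y) + Cmod (y - z).
Proof. replace (x - z)%C with ((x - y) + (y - z))%C by ring; apply Cmod_triangle. Qed.

Lemma Cmod_sub_le (x y : C) : Cmod (x - y) <= Cmod x + Cmod y.
Proof. rewrite <- (Cmod_opp y); apply Cmod_triangle. Qed.

Lemma Cmod_le_sub (x y : C) : Cmod x <= Cmod (y - x) + Cmod y.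
Proof.
  rewrite Cmod_sub_sym; pose proof (Cmod_triangle (x - y) y) as H.
  now replace (x - y + y)%C with x in H by ring.
Qed.

Lemma is_RInt_C (f : R -> C) (a b : R) (l : C) :
  is_RIntC f a b l <->
  is_RInt (fun t => fst (f t)) a b (fst l) /\ is_RInt (fun t => snd (f t)) a b (snd l).
Proof.
  split.
  - intros H; split;
      [apply (is_RInt_fct_extend_fst (U := R_NormedModule) (V := R_NormedModule)) in H
      |apply (is_RInt_fct_extend_snd (U := R_NormedModule) (V := R_NormedModule)) in H];
      exact H.
  - intros [H1 H2]; destruct l;
      apply (is_RInt_fct_extend_pair (U := R_NormedModule) (V := R_NormedModule)); auto.
Qed.

(** The values live in a module over the reals, where [scal] covers real factors only; a complex
    factor mixes the two components. *)
Lemma is_RInt_Cmult (k : C) (f : R -> C) (a b : R) (l : C) :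
  is_RIntC f a b l -> is_RIntC (fun t => k * f t)%C a b (k * l)%C.
Proof.
  rewrite !is_RInt_C; intros [H1 H2]; destruct k as [k1 k2]; split; simpl.
  - apply (is_RInt_minus (V := R_NormedModule));
      apply (is_RInt_scal (V := R_NormedModule)); assumption.
  - apply (is_RInt_plus (V := R_NormedModule));
      apply (is_RInt_scal (V := R_NormedModule)); assumption.
Qed.

Definition Ccont (g : C -> C) (z : C) : Prop :=
  forall eps, 0 < eps -> exists del, 0 < del /\
    forall u, Cmod (u - z) < del -> Cmod (g u - g z) < eps.

(* Caratheodory's form of complex differentiability: products, inverses and
   compositions need no estimates. *)
Definition Cdiff (g : C -> C) (z : C) : Prop :=
  exists phi, Ccont phi z /\ forall u, (g u = g z + phi u * (u - z))%C.

Lemma Ccont_locally (g : C -> C) (z : C) :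
  Ccont g z <-> continuous (T := C_UniformSpace) (U := C_UniformSpace) g z.
Proof.
  unfold continuous; rewrite filterlim_Cmod by apply locally_filter.
  split; intros H eps Heps; specialize (H eps Heps); apply locally_Cmod; exact H.
Qed.

Lemma continuous_comp_Ccont (g : C -> C) (c : R -> C) (t : R) :
  continuous (U := C_UniformSpace) c t -> Ccont g (c t) ->
  continuous (U := C_UniformSpace) (fun s => g (c s)) t.
Proof.
  intros H1 H2; apply Ccont_locally in H2.
  exact (continuous_comp c g t H1 H2).
Qed.

Lemma Ccont_const (k z : C) : Ccont (fun _ => k) z.
Proof.
  intros eps Heps; exists 1; split; [lra|]; intros u _.
  replace (k - k)%C with (RtoC 0) by ring; rewrite Cmod_0; exact Heps.
Qed.

Lemma Ccont_id (z : C) : Ccont (fun u => u) z.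
Proof. intros eps Heps; exists eps; auto. Qed.

Lemma Ccont_plus (f g : C -> C) (z : C) :
  Ccont f z -> Ccont g z -> Ccont (fun u => f u + g u)%C z.
Proof.
  intros Hf Hg eps Heps.
  destruct (Hf (eps / 2)) as (d1 & Hd1 & H1); [lra|].
  destruct (Hg (eps / 2)) as (d2 & Hd2 & H2); [lra|].
  exists (Rmin d1 d2); split; [now apply Rmin_pos|]; intros u Hu.
  specialize (H1 u (Rlt_le_trans _ _ _ Hu (Rmin_l _ _))).
  specialize (H2 u (Rlt_le_trans _ _ _ Hu (Rmin_r _ _))).
  replace (f u + g u - (f z + g z))%C with ((f u - f z) + (g u - g z))%C by ring.
  eapply Rle_lt_trans; [apply Cmod_triangle | lra].
Qed.

Lemma filterlim_Cmult {T : Type} (F : (T -> Prop) -> Prop) {FF : Filter F}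
    (f g : T -> C) (a b : C) :
  filterlim f F (locally (T := C_UniformSpace) a) ->
  filterlim g F (locally (T := C_UniformSpace) b) ->
  filterlim (fun x => f x * g x)%C F (locally (T := C_UniformSpace) (a * b)%C).
Proof.
  rewrite !filterlim_Cmod by exact FF; intros Hf Hg eps Heps.
  pose proof (Cmod_ge_0 a) as Pf; pose proof (Cmod_ge_0 b) as Pg.
  (* As [e <= 1], the quadratic error term is at most [e], so the three terms add up to at most
     [e * m], half of [eps]. *)
  set (m := Cmod a + Cmod b + 1) in *.
  set (e := Rmin 1 (eps / (2 * m))).
  assert (Hm : 1 <= m) by (unfold m; lra).
  assert (He : 0 < e) by (apply Rmin_pos; [lra | apply Rdiv_lt_0_compat; lra]).
  assert (He1 : e <= 1) by apply Rmin_l.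
  assert (He2 : e * m <= eps / 2).
  { apply Rle_trans with (eps / (2 * m) * m);
      [apply Rmult_le_compat_r; [lra | apply Rmin_r] | right; field; lra]. }
  generalize (filter_and _ _ (Hf e He) (Hg e He)); apply filter_imp; intros x [H1 H2].
  replace (f x * g x - a * b)%C
    with ((f x - a) * (g x - b) + (f x - a) * b + a * (g x - b))%C by ring.
  eapply Rle_lt_trans; [apply Cmod_triangle|].
  eapply Rle_lt_trans; [apply Rplus_le_compat_r, Cmod_triangle|].
  rewrite !Cmod_mult.
  pose proof (Cmod_ge_0 (f x - a)); pose proof (Cmod_ge_0 (g x - b)).
  assert (Cmod (f x - a) * Cmod (g x - b) <= e * 1) by (apply Rmult_le_compat; lra).
  assert (Cmod (f x - a) * Cmod b <= e * Cmod b) by (apply Rmult_le_compat_r; lra).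
  assert (Cmod a * Cmod (g x - b) <= Cmod a * e) by (apply Rmult_le_compat_l; lra).
  unfold m in He2; nra.
Qed.

Lemma Ccont_mult (f g : C -> C) (z : C) :
  Ccont f z -> Ccont g z -> Ccont (fun u => f u * g u)%C z.
Proof.
  rewrite !Ccont_locally; intros Hf Hg.
  apply filterlim_Cmult; [apply locally_filter | exact Hf | exact Hg].
Qed.

Lemma Ccont_inv (f : C -> C) (z : C) :
  Ccont f z -> f z <> RtoC 0 -> Ccont (fun u => / f u)%C z.
Proof.
  intros Hf Hz eps Heps.
  apply Cmod_gt_0 in Hz; set (m := Cmod (f z)) in *.
  (* The first bound keeps [Cmod (f u)] above [m / 2]; the second then beats the denominator
     [m * (m / 2)]. *)
  destruct (Hf (Rmin (m / 2) (eps * m * m / 2))) as (d & Hd & H).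
  { apply Rmin_pos; [lra|]; assert (0 < eps * m) by nra; nra. }
  exists d; split; [exact Hd|]; intros u Hu; specialize (H u Hu).
  assert (A := Rlt_le_trans _ _ _ H (Rmin_l _ _)).
  assert (B := Rlt_le_trans _ _ _ H (Rmin_r _ _)).
  assert (Hu2 : m / 2 < Cmod (f u)).
  { pose proof (Cmod_sub_triangle (f z) (f u) (RtoC 0)) as T.
    rewrite (Cmod_sub_sym (f z) (f u)) in T.
    replace (f z - 0)%C with (f z) in T by ring.
    replace (f u - 0)%C with (f u) in T by ring; fold m in T; lra. }
  assert (Nu : f u <> RtoC 0) by (apply Cmod_gt_0; lra).
  assert (Nz : f z <> RtoC 0) by (apply Cmod_gt_0; exact Hz).
  replace (/ f u - / f z)%C with ((f z - f u) / (f u * f z))%C by (field; auto).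
  rewrite Cmod_div, Cmod_mult, Cmod_sub_sym by (now apply Cmult_neq_0).
  fold m; apply Rlt_div_l; [nra|].
  eapply Rlt_le_trans; [exact B|].
  assert (eps * m * (m / 2) <= eps * m * Cmod (f u)) by (apply Rmult_le_compat_l; nra).
  nra.
Qed.

Lemma Ccont_comp (f g : C -> C) (z : C) :
  Ccont f z -> Ccont g (f z) -> Ccont (fun u => g (f u)) z.
Proof.
  intros Hf Hg eps Heps.
  destruct (Hg eps Heps) as (d & Hd & H); destruct (Hf d Hd) as (d' & Hd' & H').
  exists d'; auto.
Qed.

Lemma Cdiff_cont (g : C -> C) (z : C) : Cdiff g z -> Ccont g z.
Proof.
  intros (phi & Hphi & E).
  assert (H : Ccont (fun u => g z + phi u * (u + - z))%C z).
  { apply Ccont_plus; [apply Ccont_const|]; apply Ccont_mult; [exact Hphi|].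
    apply Ccont_plus; [apply Ccont_id | apply Ccont_const]. }
  intros eps Heps; destruct (H eps Heps) as (d & Hd & H').
  exists d; split; [exact Hd|]; intros u Hu; specialize (H' u Hu).
  rewrite (E u); replace (g z + phi u * (u - z) - g z)%C with
    (g z + phi u * (u + - z) - (g z + phi z * (z + - z)))%C by ring; exact H'.
Qed.

Lemma Cdiff_const (k z : C) : Cdiff (fun _ => k) z.
Proof. exists (fun _ => RtoC 0); split; [apply Ccont_const | intros; ring]. Qed.

Lemma Cdiff_id (z : C) : Cdiff (fun u => u) z.
Proof. exists (fun _ => RtoC 1); split; [apply Ccont_const | intros; ring]. Qed.

Lemma Cdiff_mult (f g : C -> C) (z : C) :
  Cdiff f z -> Cdiff g z -> Cdiff (fun u => f u * g u)%C z.
Proof.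
  intros Hf Hg; pose proof (Cdiff_cont _ _ Hf) as Cf.
  destruct Hf as (p & Hp & Ep); destruct Hg as (q & Hq & Eq).
  exists (fun u => p u * g z + f u * q u)%C; split.
  - apply Ccont_plus; apply Ccont_mult; auto; apply Ccont_const.
  - intros u; rewrite (Ep u), (Eq u); ring.
Qed.

Lemma Cdiff_iff (g : C -> C) (z : C) :
  Cdiff g z <->
  exists l, forall eps, 0 < eps -> exists del, 0 < del /\
    forall u, Cmod (u - z) < del ->
      Cmod (g u - g z - l * (u - z)) <= eps * Cmod (u - z).
Proof.
  split.
  - intros (phi & Hphi & E); exists (phi z); intros eps Heps.
    destruct (Hphi eps Heps) as (d & Hd & H).
    exists d; split; [exact Hd|]; intros u Hu; rewrite (E u).
    replace (g z + phi u * (u - z) - g z - phi z * (u - z))%C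
      with ((phi u - phi z) * (u - z))%C by ring.
    rewrite Cmod_mult; apply Rmult_le_compat_r; [apply Cmod_ge_0|].
    left; auto.
  - intros (l & H).
    (* The difference quotient, completed by the derivative [l] at [z], where division would give a
       meaningless value. *)
    exists (fun u => if excluded_middle_informative (u = z) then l
                     else ((g u - g z) / (u - z))%C); split.
    + intros eps Heps; destruct (H (eps / 2)) as (d & Hd & H'); [lra|].
      exists d; split; [exact Hd|]; intros u Hu.
      destruct (excluded_middle_informative (z = z)) as [_|n]; [|now destruct n].
      destruct (excluded_middle_informative (u = z)) as [_|n].
      * replace (l - l)%C with (RtoC 0) by ring; rewrite Cmod_0; exact Heps.
      * assert (Nz := Cminus_neq_0 _ _ n).
        replace ((g u - g z) / (u - z) - l)%C
          with ((g u - g z - l * (u - z)) / (u - z))%C by (field; exact Nz).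
        rewrite Cmod_div by exact Nz; apply Cmod_gt_0 in Nz.
        apply Rlt_div_l; [exact Nz|]; specialize (H' u Hu); nra.
    + intros u; destruct (excluded_middle_informative (u = z)) as [->|n]; [ring|].
      field; now apply Cminus_neq_0.
Qed.

Lemma Cdiff_ext_loc (f g : C -> C) (z : C) (d : R) : 0 < d ->
  (forall u, Cmod (u - z) < d -> f u = g u) -> Cdiff f z -> Cdiff g z.
Proof.
  intros Hd E; rewrite !Cdiff_iff; intros (l & H); exists l; intros eps Heps.
  destruct (H eps Heps) as (d' & Hd' & H').
  exists (Rmin d d'); split; [now apply Rmin_pos|]; intros u Hu.
  rewrite <- !E; [apply H', (Rlt_le_trans _ _ _ Hu (Rmin_r _ _)) | |].
  - replace (z - z)%C with (RtoC 0) by ring; rewrite Cmod_0; exact Hd.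
  - exact (Rlt_le_trans _ _ _ Hu (Rmin_l _ _)).
Qed.

Lemma Ccont_neq_0 (f : C -> C) (z : C) : Ccont f z -> f z <> RtoC 0 ->
  exists d, 0 < d /\ forall u, Cmod (u - z) < d -> f u <> RtoC 0.
Proof.
  intros Hf Hz; destruct (Hf (Cmod (f z))) as (d & Hd & H); [now apply Cmod_gt_0|].
  exists d; split; [exact Hd|]; intros u Hu E; specialize (H u Hu).
  rewrite E in H; replace (0 - f z)%C with (- f z)%C in H by ring.
  rewrite Cmod_opp in H; lra.
Qed.

Lemma Cdiff_inv (f : C -> C) (z : C) :
  Cdiff f z -> f z <> RtoC 0 -> Cdiff (fun u => / f u)%C z.
Proof.
  intros Hf Hz; pose proof (Cdiff_cont _ _ Hf) as Cf.
  destruct (Ccont_neq_0 _ _ Cf Hz) as (d & Hd & Hn).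
  destruct Hf as (p & Hp & Ep).
  (* Caratheodory's identity has to hold at every [u], also where [f u = 0]. The right-hand side is
     differentiable in that global sense and agrees with the inverse of [f] where [f] does not
     vanish. *)
  apply (Cdiff_ext_loc (fun u => / f z + (- (p u * (/ f u * / f z))) * (u - z))%C _ _ d Hd).
  - intros u Hu; specialize (Hn u Hu).
    replace (/ f z + - (p u * (/ f u * / f z)) * (u - z))%C
      with (/ f z + - (p u * (u - z)) * (/ f u * / f z))%C by ring.
    replace (p u * (u - z))%C with (f u - f z)%C by (rewrite (Ep u); ring).
    field; auto.
  - exists (fun u => (- (1)) * (p u * (/ f u * / f z)))%C; split.
    + apply Ccont_mult; [apply Ccont_const|].
      apply Ccont_mult; [exact Hp|].
      apply Ccont_mult; [now apply Ccont_inv | apply Ccont_const].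
    + intros u; ring.
Qed.

Lemma Cdiff_comp (f g : C -> C) (z : C) :
  Cdiff f z -> Cdiff g (f z) -> Cdiff (fun u => g (f u)) z.
Proof.
  intros Hf (q & Hq & Eq); pose proof (Cdiff_cont _ _ Hf) as Cf.
  destruct Hf as (p & Hp & Ep).
  exists (fun u => q (f u) * p u)%C; split.
  - apply Ccont_mult; [now apply Ccont_comp | exact Hp].
  - intros u; rewrite (Eq (f u)).
    replace (f u - f z)%C with (p u * (u - z))%C by (rewrite (Ep u); ring); ring.
Qed.

(** * Integrals over segments *)

Definition disc (z0 : C) (e : R) (z : C) : Prop := Cmod (z - z0) < e.

Definition seg (g : C -> C) (x y : C) (t : R) : C :=
  (g (x + t * (y - x)) * (y - x))%C.

Definition seg_int (g : C -> C) (x y : C) : C := RIntC (seg g x y) 0 1.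

Definition holo_on (g : C -> C) (V : C -> Prop) : Prop := forall z, V z -> Cdiff g z.

Lemma convex_bound (x y z0 : C) (t m : R) : 0 <= t <= 1 ->
  Cmod (x - z0) <= m -> Cmod (y - z0) <= m -> Cmod (x + t * (y - x) - z0) <= m.
Proof.
  intros Ht Hx Hy.
  replace (x + t * (y - x) - z0)%C
    with (RtoC (1 - t) * (x - z0) + RtoC t * (y - z0))%C
    by (rewrite RtoC_minus; ring).
  eapply Rle_trans; [apply Cmod_triangle|].
  rewrite !Cmod_mult, !Cmod_R, !Rabs_pos_eq by lra; nra.
Qed.

Lemma disc_convex (z0 : C) (e : R) (x y : C) (t : R) : 0 <= t <= 1 ->
  disc z0 e x -> disc z0 e y -> disc z0 e (x + t * (y - x)).
Proof.
  unfold disc; intros Ht Hx Hy.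
  apply Rle_lt_trans with (Rmax (Cmod (x - z0)) (Cmod (y - z0))).
  - apply convex_bound; [exact Ht | apply Rmax_l | apply Rmax_r].
  - now apply Rmax_lub_lt.
Qed.

Lemma segment_continuous (x h : C) (t : R) :
  continuous (U := C_UniformSpace) (fun s : R => x + s * h)%C t.
Proof.
  apply filterlim_Cmod; [apply locally_filter|]; intros eps Heps.
  assert (P := Cmod_ge_0 h).
  assert (He : 0 < eps / (Cmod h + 1)) by (apply Rdiv_lt_0_compat; lra).
  exists (mkposreal _ He); intros s Hs; simpl in Hs.
  change (Rabs (s - t) < eps / (Cmod h + 1)) in Hs.
  replace (x + s * h - (x + t * h))%C with (RtoC (s - t) * h)%C
    by (rewrite RtoC_minus; ring).
  rewrite Cmod_mult, Cmod_R.
  apply Rlt_div_r in Hs; [|lra].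
  pose proof (Rabs_pos (s - t)); nra.
Qed.

Lemma seg_continuous (g : C -> C) (x y : C) (t : R) :
  Ccont g (x + t * (y - x))%C -> continuous (U := C_UniformSpace) (seg g x y) t.
Proof.
  intros H.
  apply (continuous_comp_Ccont (fun w => g w * (y - x))%C (fun s : R => x + s * (y - x))%C).
  - apply segment_continuous.
  - apply Ccont_mult; [exact H | apply Ccont_const].
Qed.

Section Segments.

Variables (g : C -> C) (z0 : C) (e : R).
Hypothesis Hg : holo_on g (disc z0 e).

Lemma is_RInt_seg (x y : C) : disc z0 e x -> disc z0 e y ->
  is_RIntC (seg g x y) 0 1 (seg_int g x y).
Proof.
  intros Hx Hy; apply (RInt_correct (V := C_R_CompleteNormedModule)).
  apply (ex_RInt_continuous (V := C_R_CompleteNormedModule)); intros t Ht.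
  rewrite Rmin_left, Rmax_right in Ht by lra.
  apply seg_continuous, Cdiff_cont, Hg, disc_convex; assumption.
Qed.

(** An affine change of parameter. No order is imposed on [s1] and [s2], so the same lemma yields
    reversal (from 1 to 0) and bisection (at one half). *)
Lemma seg_int_sub (x y : C) (s1 s2 : R) : disc z0 e x -> disc z0 e y ->
  0 <= s1 <= 1 -> 0 <= s2 <= 1 ->
  seg_int g (x + s1 * (y - x)) (x + s2 * (y - x)) = RIntC (seg g x y) s1 s2.
Proof.
  intros Hx Hy H1 H2.
  apply (is_RInt_unique (V := C_R_CompleteNormedModule)).
  apply (is_RInt_ext (V := C_R_NormedModule)
    (fun t => scal (V := C_R_NormedModule) (s2 - s1) (seg g x y ((s2 - s1) * t + s1)))).
  - intros t _; rewrite C_R_scal; unfold seg.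
    match goal with |- @eq _ ?u ?v => change (@eq C u v) end.
    rewrite RtoC_plus, RtoC_mult, RtoC_minus.
    replace (x + s1 * (y - x) + t * (x + s2 * (y - x) - (x + s1 * (y - x))))%C
      with (x + ((s2 - s1) * t + s1) * (y - x))%C by ring; ring.
  - apply (is_RInt_comp_lin (V := C_R_NormedModule)).
    replace ((s2 - s1) * 0 + s1) with s1 by ring.
    replace ((s2 - s1) * 1 + s1) with s2 by ring.
    apply (RInt_correct (V := C_R_CompleteNormedModule)).
    apply (ex_RInt_continuous (V := C_R_CompleteNormedModule)); intros t Ht.
    apply seg_continuous, Cdiff_cont, Hg, disc_convex; auto.
    split; [apply Rle_trans with (Rmin s1 s2) | apply Rle_trans with (Rmax s1 s2)]; try apply Ht.
    + now apply Rmin_glb.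
    + now apply Rmax_lub.
Qed.

Lemma seg_int_rev (x y : C) : disc z0 e x -> disc z0 e y ->
  seg_int g y x = (- seg_int g x y)%C.
Proof.
  intros Hx Hy; assert (H := seg_int_sub x y 1 0 Hx Hy ltac:(lra) ltac:(lra)).
  replace (x + 1 * (y - x))%C with y in H by ring.
  replace (x + 0 * (y - x))%C with x in H by ring.
  rewrite H; symmetry; apply (opp_RInt_swap (V := C_R_CompleteNormedModule)).
  eexists; apply (is_RInt_seg x y Hx Hy).
Qed.

Lemma seg_int_mid (x y : C) : disc z0 e x -> disc z0 e y ->
  (seg_int g x y = seg_int g x ((x + y) / 2) + seg_int g ((x + y) / 2) y)%C.
Proof.
  intros Hx Hy.
  assert (H1 := seg_int_sub x y 0 (/ 2) Hx Hy ltac:(lra) ltac:(lra)).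
  assert (H2 := seg_int_sub x y (/ 2) 1 Hx Hy ltac:(lra) ltac:(lra)).
  assert (D2 : RtoC 2 <> RtoC 0) by (intros E; injection E; lra).
  replace (x + 1 * (y - x))%C with y in H2 by ring.
  replace (x + 0 * (y - x))%C with x in H1 by ring.
  rewrite RtoC_inv in H1, H2 by lra.
  replace (x + / 2 * (y - x))%C with ((x + y) / 2)%C in H1, H2 by (field; exact D2).
  rewrite H1, H2; symmetry.
  assert (E : ex_RInt (V := C_R_CompleteNormedModule) (seg g x y) 0 1)
    by (eexists; apply (is_RInt_seg x y Hx Hy)).
  apply (RInt_Chasles (V := C_R_CompleteNormedModule)).
  - apply (ex_RInt_Chasles_1 (V := C_R_CompleteNormedModule) _ 0 (/ 2) 1); [lra | exact E].
  - apply (ex_RInt_Chasles_2 (V := C_R_CompleteNormedModule) _ 0 (/ 2) 1); [lra | exact E].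
Qed.

Definition tri (a b c : C) : C := (seg_int g a b + seg_int g b c + seg_int g c a)%C.

Lemma is_RInt_affine (c0 c1 : C) :
  is_RIntC (fun t : R => c0 + t * c1)%C 0 1 (c0 + RtoC (/ 2) * c1)%C.
Proof.
  assert (A : forall p q, is_RInt (fun t => p + q * t) 0 1 (p + q / 2)).
  { intros p q.
    replace (p + q / 2) with (minus (p * 1 + q * 1 ^ 2 / 2) (p * 0 + q * 0 ^ 2 / 2))
      by (unfold minus, plus, opp; simpl; field).
    apply (is_RInt_derive (V := R_CompleteNormedModule) (fun t => p * t + q * t ^ 2 / 2)).
    - intros t _; auto_derive; [exact I | field].
    - intros t _; apply continuity_pt_filterlim.
      apply derivable_continuous_pt; exists q; apply is_derive_Reals; auto_derive; [exact I|ring]. }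
  apply is_RInt_C; destruct c0 as [u v], c1 as [u' v']; split; simpl.
  - replace (u + (/ 2 * u' - 0 * v')) with (u + u' / 2) by field.
    apply (is_RInt_ext (fun t => u + u' * t)); [|apply A].
    intros t _; match goal with |- @eq _ ?x ?y => change (@eq R x y) end; ring.
  - replace (v + (/ 2 * v' + 0 * u')) with (v + v' / 2) by field.
    apply (is_RInt_ext (fun t => v + v' * t)); [|apply A].
    intros t _; match goal with |- @eq _ ?x ?y => change (@eq R x y) end; ring.
Qed.

(* Up to the boundary term of a primitive of its affine part, the integral is
   that of the remainder. *)
Lemma seg_int_affine_approx (k l w : C) (x y : C) (M : R) : disc z0 e x -> disc z0 e y ->
  (forall t, 0 <= t <= 1 ->
     let u := (x + t * (y - x))%C in Cmod (g u - k - l * (u - w)) <= M) ->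
  Cmod (seg_int g x y - ((k - l * w) * y + l * y * y / 2 - ((k - l * w) * x + l * x * x / 2)))
    <= M * Cmod (y - x).
Proof.
  intros Hx Hy H; rewrite <- C_R_norm.
  replace (M * Cmod (y - x)) with ((1 - 0) * (M * Cmod (y - x))) by ring.
  assert (D2 : RtoC 2 <> RtoC 0) by (intros E; injection E; lra).
  apply (norm_RInt_le_const (V := C_R_NormedModule)
    (fun t : R => seg g x y t - ((k + l * (x - w)) * (y - x) + t * (l * (y - x) * (y - x))))%C);
    [lra | |].
  - intros t Ht; rewrite C_R_norm; unfold seg.
    replace (g (x + t * (y - x)) * (y - x)
        - ((k + l * (x - w)) * (y - x) + t * (l * (y - x) * (y - x))))%C
      with ((g (x + t * (y - x)) - k - l * (x + t * (y - x) - w)) * (y - x))%C by ring.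
    rewrite Cmod_mult; apply Rmult_le_compat_r; [apply Cmod_ge_0 | apply (H t Ht)].
  - apply (is_RInt_minus (V := C_R_NormedModule)); [now apply is_RInt_seg|].
    replace ((k - l * w) * y + l * y * y / 2 - ((k - l * w) * x + l * x * x / 2))%C
      with ((k + l * (x - w)) * (y - x) + RtoC (/ 2) * (l * (y - x) * (y - x)))%C
      by (rewrite RtoC_inv by lra; field; exact D2).
    apply is_RInt_affine.
Qed.

End Segments.

(** * Goursat's lemma *)

(** The intervals of radius [2 * L / 2 ^ n] around [u n] are nested, so the supremum of their left
    ends lies in all of them. This gives the rate of convergence together with the limit. *)
Lemma geometric_limit_R (u : nat -> R) (L : R) :
  (forall n, Rabs (u (S n) - u n) <= L / 2 ^ n) ->
  exists l, forall n, Rabs (u n - l) <= 2 * L / 2 ^ n.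
Proof.
  intros H.
  assert (P : forall n, 0 < 2 ^ n) by (intros; apply pow_lt; lra).
  set (lo := fun n => u n - 2 * L / 2 ^ n); set (hi := fun n => u n + 2 * L / 2 ^ n).
  assert (E : forall n, 2 * L / 2 ^ S n = L / 2 ^ n)
    by (intros n; simpl; field; specialize (P n); lra).
  assert (E2 : forall n, 2 * L / 2 ^ n = L / 2 ^ n + L / 2 ^ n)
    by (intros n; field; specialize (P n); lra).
  assert (L0 : forall n, 0 <= L / 2 ^ n)
    by (intros n; specialize (H n); pose proof (Rabs_pos (u (S n) - u n)); lra).
  assert (Hlo : forall n k, lo n <= lo (k + n)%nat).
  { intros n k; induction k as [|k IH]; [simpl; lra|].
    change (S k + n)%nat with (S (k + n)); unfold lo in *.
    rewrite E; rewrite (E2 (k + n)%nat) in IH.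
    specialize (H (k + n)%nat); apply Rabs_le_between in H; lra. }
  assert (Hhi : forall n k, hi (k + n)%nat <= hi n).
  { intros n k; induction k as [|k IH]; [simpl; lra|].
    change (S k + n)%nat with (S (k + n)); unfold hi in *.
    rewrite E; rewrite (E2 (k + n)%nat) in IH.
    specialize (H (k + n)%nat); apply Rabs_le_between in H; lra. }
  assert (Hlh : forall n m, lo n <= hi m).
  { intros n m; apply Rle_trans with (lo (m + n)%nat); [apply Hlo|].
    apply Rle_trans with (hi (n + m)%nat); [|apply Hhi].
    rewrite (Nat.add_comm m n); unfold lo, hi; rewrite E2; specialize (L0 (n + m)%nat); lra. }
  destruct (completeness (fun x => exists n, x = lo n)) as (l & Hub & Hl).
  - exists (hi O); intros x (n & ->); apply Hlh.
  - exists (lo O), O; reflexivity.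
  - exists l; intros n.
    assert (A : lo n <= l) by (apply Hub; now exists n).
    assert (B : l <= hi n) by (apply Hl; intros x (k & ->); apply Hlh).
    unfold lo in A; unfold hi in B; apply Rabs_le_between; lra.
Qed.

Lemma geometric_limit (u : nat -> C) (L : R) :
  (forall n, Cmod (u (S n) - u n) <= L / 2 ^ n) ->
  exists l : C, forall n, Cmod (u n - l) <= 4 * L / 2 ^ n.
Proof.
  intros H.
  destruct (geometric_limit_R (fun n => fst (u n)) L) as (l1 & H1).
  { intros n; eapply Rle_trans; [|apply (H n)].
    eapply Rle_trans; [|apply Rmax_Cmod]; apply Rmax_l. }
  destruct (geometric_limit_R (fun n => snd (u n)) L) as (l2 & H2).
  { intros n; eapply Rle_trans; [|apply (H n)].
    eapply Rle_trans; [|apply Rmax_Cmod]; apply Rmax_r. }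
  (* Each component contributes [2 * L / 2 ^ n], whence the factor 4. *)
  exists (l1, l2); intros n.
  replace (u n - (l1, l2))%C
    with (RtoC (fst (u n) - l1) + Ci * RtoC (snd (u n) - l2))%C
    by (destruct (u n); unfold Cminus, Cplus, Cmult, Copp, Ci, RtoC; simpl; f_equal; ring).
  eapply Rle_trans; [apply Cmod_triangle|].
  rewrite Cmod_mult, Cmod_Ci, !Cmod_R.
  replace (4 * L / 2 ^ n) with (2 * L / 2 ^ n + 1 * (2 * L / 2 ^ n)) by (unfold Rdiv; ring).
  specialize (H1 n); specialize (H2 n); simpl in *; lra.
Qed.

Definition triangle : Type := (C * C * C)%type.

Definition sides_le (T : triangle) (L : R) : Prop :=
  let '(a, b, c) := T in
  Cmod (a - b) <= L /\ Cmod (b - c) <= L /\ Cmod (c - a) <= L.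

Definition vertices_in (T : triangle) (P : C -> Prop) : Prop :=
  let '(a, b, c) := T in P a /\ P b /\ P c.

Definition apex (T : triangle) : C := fst (fst T).

Definition boundary_int (g : C -> C) (T : triangle) : C :=
  let '(a, b, c) := T in tri g a b c.

Lemma Cmod_half (u x y : C) (L : R) :
  u = (RtoC (/ 2) * (x - y))%C -> Cmod (x - y) <= L -> Cmod u <= L / 2.
Proof.
  intros -> H; rewrite Cmod_mult, Cmod_R, Rabs_pos_eq by lra; lra.
Qed.

Lemma midpoint_convex (x y : C) : ((x + y) / 2 = x + RtoC (/ 2) * (y - x))%C.
Proof. rewrite RtoC_inv by lra; field; intros E; injection E; lra. Qed.

Section Goursat.

Variables (g : C -> C) (z0 : C) (e : R).
Hypothesis Hg : holo_on g (disc z0 e).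

(** The midpoints cut the triangle into four; every inner side is run through once in each
    direction, so one of the four carries at least a quarter of the integral. The closed disc of
    radius [m < e] is kept invariant so that the limit point of the nested triangles stays inside
    the open disc. *)
Lemma bisect_triangle (m : R) (T : triangle) : m < e ->
  vertices_in T (fun z => Cmod (z - z0) <= m) ->
  exists T' : triangle,
    vertices_in T' (fun z => Cmod (z - z0) <= m) /\
    Cmod (boundary_int g T) <= 4 * Cmod (boundary_int g T') /\
    forall L, sides_le T L -> sides_le T' (L / 2) /\ Cmod (apex T' - apex T) <= L / 2.
Proof.
  intros Hm; destruct T as [[a b] c]; simpl; intros (Ha & Hb & Hc).
  set (m1 := ((a + b) / 2)%C); set (m2 := ((b + c) / 2)%C); set (m3 := ((c + a) / 2)%C).
  assert (Mid : forall x y, Cmod (x - z0) <= m -> Cmod (y - z0) <= m ->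
                Cmod ((x + y) / 2 - z0) <= m).
  { intros x y Hx Hy; rewrite midpoint_convex; apply convex_bound; auto; lra. }
  assert (H1 : Cmod (m1 - z0) <= m) by now apply Mid.
  assert (H2 : Cmod (m2 - z0) <= m) by now apply Mid.
  assert (H3 : Cmod (m3 - z0) <= m) by now apply Mid.
  assert (In : forall x, Cmod (x - z0) <= m -> disc z0 e x)
    by (intros x Hx; unfold disc; lra).
  assert (Sum : tri g a b c =
    (tri g a m1 m3 + tri g m1 b m2 + (tri g m3 m2 c + tri g m1 m2 m3))%C).
  { unfold tri.
    rewrite (seg_int_mid g z0 e Hg a b), (seg_int_mid g z0 e Hg b c),
      (seg_int_mid g z0 e Hg c a) by auto.
    fold m1 m2 m3.
    rewrite (seg_int_rev g z0 e Hg m1 m3), (seg_int_rev g z0 e Hg m1 m2),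
      (seg_int_rev g z0 e Hg m2 m3) by auto; ring. }
  assert (Dis : Cmod (tri g a b c) <= 4 * Cmod (tri g a m1 m3) \/
    Cmod (tri g a b c) <= 4 * Cmod (tri g m1 b m2) \/
    Cmod (tri g a b c) <= 4 * Cmod (tri g m3 m2 c) \/
    Cmod (tri g a b c) <= 4 * Cmod (tri g m1 m2 m3)).
  { assert (Hs := Cmod_triangle (tri g a m1 m3 + tri g m1 b m2) (tri g m3 m2 c + tri g m1 m2 m3)).
    assert (Hs1 := Cmod_triangle (tri g a m1 m3) (tri g m1 b m2)).
    assert (Hs2 := Cmod_triangle (tri g m3 m2 c) (tri g m1 m2 m3)).
    rewrite <- Sum in Hs.
    destruct (Rle_dec (Cmod (tri g a b c)) (4 * Cmod (tri g a m1 m3))); [auto|].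
    destruct (Rle_dec (Cmod (tri g a b c)) (4 * Cmod (tri g m1 b m2))); [auto|].
    destruct (Rle_dec (Cmod (tri g a b c)) (4 * Cmod (tri g m3 m2 c))); [auto|].
    right; right; right; lra. }
  assert (D2 : RtoC 2 <> RtoC 0) by (intros E; injection E; lra).
  (* Each side of a part, and each displacement of the apex, is half the difference of two old
     vertices. An apex that does not move is treated as half of [a - a], which is what [L0] is
     for. *)
  destruct Dis as [D|[D|[D|D]]];
    [exists (a, m1, m3) | exists (m1, b, m2) | exists (m3, m2, c) | exists (m1, m2, m3)];
    (split; [simpl; auto|]); (split; [exact D|]);
    intros L (L1 & L2 & L3); unfold sides_le, apex; simpl; unfold m1, m2, m3;
    assert (L0 : Cmod (a - a) <= L)
      by (replace (a - a)%C with (RtoC 0) by ring; rewrite Cmod_0;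
          eapply Rle_trans; [apply Cmod_ge_0 | exact L1]);
    rewrite (Cmod_sub_sym a b) in L1;
    assert (L1' := L1); rewrite (Cmod_sub_sym b a) in L1';
    assert (L2' := L2); rewrite (Cmod_sub_sym b c) in L2';
    assert (L3' := L3); rewrite (Cmod_sub_sym c a) in L3';
    repeat split;
    first [ eapply Cmod_half; [|exact L1]; rewrite RtoC_inv by lra; field; exact D2
          | eapply Cmod_half; [|exact L1']; rewrite RtoC_inv by lra; field; exact D2
          | eapply Cmod_half; [|exact L2]; rewrite RtoC_inv by lra; field; exact D2
          | eapply Cmod_half; [|exact L2']; rewrite RtoC_inv by lra; field; exact D2
          | eapply Cmod_half; [|exact L3]; rewrite RtoC_inv by lra; field; exact D2
          | eapply Cmod_half; [|exact L3']; rewrite RtoC_inv by lra; field; exact D2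
          | eapply Cmod_half; [|exact L0]; rewrite RtoC_inv by lra; field; exact D2 ].
Qed.

Theorem goursat (a b c : C) : disc z0 e a -> disc z0 e b -> disc z0 e c ->
  tri g a b c = RtoC 0.
Proof.
  unfold disc; intros Ha Hb Hc.
  set (m := Rmax (Cmod (a - z0)) (Rmax (Cmod (b - z0)) (Cmod (c - z0)))).
  assert (Hm : m < e) by (repeat apply Rmax_lub_lt; assumption).
  set (L := Cmod (a - b) + Cmod (b - c) + Cmod (c - a)).
  assert (La := Cmod_ge_0 (a - b)); assert (Lb := Cmod_ge_0 (b - c));
    assert (Lc := Cmod_ge_0 (c - a)).
  set (V := fun z => Cmod (z - z0) <= m).
  assert (Step : exists F : triangle -> triangle, forall T, vertices_in T V ->
    vertices_in (F T) V /\ Cmod (boundary_int g T) <= 4 * Cmod (boundary_int g (F T)) /\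
    forall L, sides_le T L -> sides_le (F T) (L / 2) /\ Cmod (apex (F T) - apex T) <= L / 2).
  { apply choice with (R := fun T T' => vertices_in T V ->
      vertices_in T' V /\ Cmod (boundary_int g T) <= 4 * Cmod (boundary_int g T') /\
      forall L, sides_le T L -> sides_le T' (L / 2) /\ Cmod (apex T' - apex T) <= L / 2).
    intros T; destruct (classic (vertices_in T V)) as [HT|HT].
    - destruct (bisect_triangle m T Hm HT) as (T' & H); exists T'; auto.
    - exists T; intros H; contradiction. }
  destruct Step as (F & HF).
  set (T := fun n => Nat.iter n F (a, b, c)).
  assert (P : forall n, 0 < 2 ^ n) by (intros; apply pow_lt; lra).
  assert (Inv : forall n, vertices_in (T n) V /\ sides_le (T n) (L / 2 ^ n) /\
            Cmod (tri g a b c) <= 4 ^ n * Cmod (boundary_int g (T n))).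
  { induction n as [|n (I1 & I2 & I3)].
    - simpl; unfold V; repeat split; unfold m, L.
      + apply Rmax_l.
      + eapply Rle_trans; [apply Rmax_l | apply Rmax_r].
      + eapply Rle_trans; [apply Rmax_r | apply Rmax_r].
      + unfold Rdiv; rewrite Rinv_1; lra.
      + unfold Rdiv; rewrite Rinv_1; lra.
      + unfold Rdiv; rewrite Rinv_1; lra.
      + lra.
    - destruct (HF (T n) I1) as (J1 & J2 & J3); change (T (S n)) with (F (T n)).
      split; [exact J1 | split].
      + replace (L / 2 ^ S n) with (L / 2 ^ n / 2) by (simpl; field; specialize (P n); lra).
        now apply J3.
      + eapply Rle_trans; [exact I3|]; simpl.
        pose proof (pow_lt 4 n ltac:(lra)); nra. }
  destruct (geometric_limit (fun n => apex (T n)) L) as (w & Hw).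
  { intros n; destruct (Inv n) as (I1 & I2 & _); destruct (HF (T n) I1) as (_ & _ & J3).
    change (T (S n)) with (F (T n)); eapply Rle_trans; [apply (J3 _ I2)|].
    assert (0 <= L / 2 ^ n)
      by (apply Rdiv_le_0_compat; [unfold L; lra | apply P]); lra. }
  assert (Small : forall eta, 0 < eta -> exists n, L / 2 ^ n < eta).
  { intros eta Heta.
    destruct (pow_lt_1_zero (/ 2) ltac:(rewrite Rabs_pos_eq; lra) (eta / (L + 1))) as (n & Hn).
    { apply Rdiv_lt_0_compat; unfold L; lra. }
    exists n; specialize (Hn n (le_n n)); rewrite Rabs_pos_eq in Hn by (apply pow_le; lra).
    rewrite pow_inv in Hn; apply Rlt_div_r in Hn; [|unfold L; lra].
    unfold Rdiv; assert (0 < / 2 ^ n) by (apply Rinv_0_lt_compat, P); nra. }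
  assert (Hwm : Cmod (w - z0) <= m).
  { apply Rnot_lt_le; intros Hlt.
    destruct (Small ((Cmod (w - z0) - m) / 4)) as (n & Hn); [lra|].
    destruct (Inv n) as (I1 & _ & _); specialize (Hw n).
    assert (Ia : Cmod (apex (T n) - z0) <= m)
      by (destruct (T n) as [[x y] z]; apply I1).
    pose proof (Cmod_sub_triangle w (apex (T n)) z0) as Tr.
    rewrite Cmod_sub_sym in Hw; unfold Rdiv in *; lra. }
  assert (Hdw : disc z0 e w) by (unfold disc; lra).
  destruct (proj1 (Cdiff_iff g w) (Hg w Hdw)) as (l & Hl).
  apply Cmod_eq_0, Rle_antisym; [|apply Cmod_ge_0].
  apply Rnot_lt_le; intros Heta.
  set (eta := Cmod (tri g a b c)) in *.
  (* Each of the three edges will cost [5 * eps * Ln ^ 2], whence 15. The summand 1 makes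
     [15 * eps * L * L] strictly less than [eta] and covers [L = 0]. *)
  set (eps := eta / (15 * L * L + 1)).
  assert (HLL : 0 < 15 * L * L + 1) by (unfold L; nra).
  assert (Heps : 0 < eps) by (apply Rdiv_lt_0_compat; assumption).
  destruct (Hl eps Heps) as (del & Hdel & Hdiff).
  (* The apex is within [4 * Ln] of [w] and the sides are at most [Ln], so the triangle lies within
     [5 * Ln < del]. *)
  destruct (Small (del / 5)) as (n & Hn); [lra|].
  destruct (Inv n) as (I1 & I2 & I3); specialize (Hw n).
  set (Ln := L / 2 ^ n) in *.
  assert (HLn : 0 <= Ln) by (apply Rdiv_le_0_compat; [unfold L; lra | apply P]).
  replace (4 * L / 2 ^ n) with (4 * Ln) in Hw by (unfold Ln, Rdiv; ring).
  destruct (T n) as [[x y] z]; simpl in I1, I2, I3, Hw; unfold apex in Hw; simpl in Hw.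
  destruct I1 as (Vx & Vy & Vz); destruct I2 as (S1 & S2 & S3).
  assert (Near : Cmod (x - w) <= 5 * Ln /\ Cmod (y - w) <= 5 * Ln /\ Cmod (z - w) <= 5 * Ln).
  { split; [lra|split].
    - pose proof (Cmod_sub_triangle y x w); rewrite Cmod_sub_sym in S1; lra.
    - pose proof (Cmod_sub_triangle z x w); lra. }
  destruct Near as (Nx & Ny & Nz).
  assert (In : forall u, V u -> disc z0 e u) by (intros u Hu; unfold disc, V in *; lra).
  (* A primitive of the affine approximation of [g] at [w]; its increments cancel around the
     triangle, leaving the remainder alone. *)
  set (A := fun u => ((g w - l * w) * u + l * u * u / 2)%C).
  assert (Edge : forall u v, V u -> V v -> Cmod (u - w) <= 5 * Ln -> Cmod (v - w) <= 5 * Ln ->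
    Cmod (v - u) <= Ln -> Cmod (seg_int g u v - (A v - A u)) <= eps * (5 * Ln) * Ln).
  { intros u v Vu Vv Hu Hv Huv.
    eapply Rle_trans.
    - apply (seg_int_affine_approx g z0 e Hg (g w) l w u v (eps * (5 * Ln))); auto.
      intros t Ht; cbv zeta.
      assert (B := convex_bound u v w t (5 * Ln) Ht Hu Hv).
      eapply Rle_trans; [apply Hdiff; lra|].
      apply Rmult_le_compat_l; lra.
    - apply Rmult_le_compat_l; [|exact Huv]; nra. }
  rewrite (Cmod_sub_sym x y) in S1; rewrite (Cmod_sub_sym y z) in S2;
    rewrite (Cmod_sub_sym z x) in S3.
  assert (E1 := Edge x y Vx Vy Nx Ny S1); assert (E2 := Edge y z Vy Vz Ny Nz S2);
    assert (E3 := Edge z x Vz Vx Nz Nx S3).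
  assert (B : Cmod (tri g x y z) <= 15 * eps * Ln * Ln).
  { replace (tri g x y z) with ((seg_int g x y - (A y - A x)) +
      (seg_int g y z - (A z - A y)) + (seg_int g z x - (A x - A z)))%C
      by (unfold tri; ring).
    eapply Rle_trans; [apply Cmod_triangle|].
    eapply Rle_trans; [apply Rplus_le_compat_r, Cmod_triangle|]; lra. }
  assert (Hfin : eta <= 15 * eps * L * L).
  (* [Ln ^ 2] equals [L ^ 2 / 4 ^ n], which compensates exactly the factor 4 lost at each
     bisection. *)
  { apply Rle_trans with (4 ^ n * (15 * eps * Ln * Ln)).
    - eapply Rle_trans; [exact I3|]; apply Rmult_le_compat_l; [apply pow_le; lra | exact B].
    - right; unfold Ln; replace 4 with (2 * 2) by ring; rewrite Rpow_mult_distr.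
      field; specialize (P n); lra. }
  assert (eps * (15 * L * L + 1) = eta) by (unfold eps; field; lra).
  lra.
Qed.

Definition local_primitive (z : C) : C := seg_int g z0 z.

Lemma seg_int_primitive (x y : C) : disc z0 e x -> disc z0 e y ->
  seg_int g x y = (local_primitive y - local_primitive x)%C.
Proof.
  intros Hx Hy; unfold local_primitive.
  assert (H0 : disc z0 e z0).
  { unfold disc in *; replace (z0 - z0)%C with (RtoC 0) by ring; rewrite Cmod_0.
    eapply Rle_lt_trans; [apply Cmod_ge_0 | exact Hx]. }
  assert (H := goursat z0 x y H0 Hx Hy); unfold tri in H.
  rewrite (seg_int_rev g z0 e Hg z0 y) in H by assumption.
  replace (seg_int g x y) with (seg_int g z0 x + seg_int g x y + - seg_int g z0 y
    + (seg_int g z0 y - seg_int g z0 x))%C by ring.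
  rewrite H; ring.
Qed.

Lemma local_primitive_approx (z : C) (eps : R) : disc z0 e z -> 0 < eps ->
  exists del, 0 < del /\ forall u, Cmod (u - z) < del ->
    Cmod (local_primitive u - local_primitive z - g z * (u - z)) <= eps * Cmod (u - z).
Proof.
  intros Hz Heps.
  destruct (Cdiff_cont _ _ (Hg z Hz) eps Heps) as (d & Hd & H).
  unfold disc in Hz.
  exists (Rmin d (e - Cmod (z - z0))); split; [apply Rmin_pos; lra|].
  intros u Hu.
  assert (Hu1 := Rlt_le_trans _ _ _ Hu (Rmin_l _ _)).
  assert (Hu2 := Rlt_le_trans _ _ _ Hu (Rmin_r _ _)).
  assert (Du : disc z0 e u)
    by (unfold disc; pose proof (Cmod_sub_triangle u z z0); lra).
  rewrite <- seg_int_primitive by assumption.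
  (* The approximating function is taken constant: value [g z], slope and base point 0. Continuity
     of [g] at [z] then suffices. *)
  replace (g z * (u - z))%C with ((g z - 0 * 0) * u + 0 * u * u / 2 -
    ((g z - 0 * 0) * z + 0 * z * z / 2))%C by (unfold Cdiv; ring).
  apply (seg_int_affine_approx g z0 e Hg (g z) 0 0); auto.
  intros t Ht; cbv zeta.
  replace (g (z + t * (u - z)) - g z - 0 * (z + t * (u - z) - 0))%C
    with (g (z + t * (u - z)) - g z)%C by ring.
  left; apply H.
  replace (z + t * (u - z) - z)%C with (t * (u - z))%C by ring.
  rewrite Cmod_mult, Cmod_R, Rabs_pos_eq by lra.
  pose proof (Cmod_ge_0 (u - z)); nra.
Qed.

End Goursat.

(** * Paths inside a disc *)

(** Composition with [clamp u v] turns a function continuous only on [[u, v]] into one continuous at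
    every real point, which the integrability and mean value lemmas can use. *)
Definition clamp (u v t : R) : R := Rmax u (Rmin t v).

Lemma clamp_in (u v t : R) : u <= v -> u <= clamp u v t <= v.
Proof.
  intros H; unfold clamp; split; [apply Rmax_l|].
  apply Rmax_lub; [exact H | apply Rmin_r].
Qed.

Lemma clamp_id (u v t : R) : u <= t <= v -> clamp u v t = t.
Proof. intros H; unfold clamp; rewrite Rmin_left, Rmax_right; lra. Qed.

Lemma clamp_lipschitz (u v s t : R) : Rabs (clamp u v s - clamp u v t) <= Rabs (s - t).
Proof.
  unfold clamp, Rmax, Rmin.
  repeat destruct Rle_dec; apply Rabs_le_between; unfold Rabs; destruct Rcase_abs; lra.
Qed.

Lemma clamp_filterlim (u v t : R) (D : R -> Prop) : u <= v ->
  (forall s, u <= s <= v -> D s) ->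
  filterlim (clamp u v) (locally t) (within D (locally (clamp u v t))).
Proof.
  intros Huv HD P (eps & HP); exists eps; intros s Hs.
  apply HP; [|apply HD, clamp_in, Huv].
  change (Rabs (clamp u v s - clamp u v t) < eps).
  eapply Rle_lt_trans; [apply clamp_lipschitz | exact Hs].
Qed.

Lemma continuous_clamp {U : UniformSpace} (f : R -> U) (D : R -> Prop) (u v : R) :
  u <= v -> (forall s, u <= s <= v -> D s) ->
  continuous_on (T := R_UniformSpace) D f ->
  forall t, continuous (fun s => f (clamp u v s)) t.
Proof.
  intros Huv HD Hf t; unfold continuous.
  eapply filterlim_comp; [now apply (clamp_filterlim u v t D)|].
  apply Hf, HD, clamp_in, Huv.
Qed.

(** An arc has a derivative only between its ends. The difference of [F] and the integral of [phi]
    has derivative zero there and is continuous up to the ends, so the mean value theorem makes it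
    constant. *)
Lemma ftc_open_interval (F phi : R -> R) (u v : R) : u <= v ->
  (forall t, u < t < v -> is_derive F t (phi t)) ->
  (forall t, u <= t <= v -> continuous F t) ->
  (forall t, continuous phi t) ->
  is_RInt phi u v (F v - F u).
Proof.
  intros Huv HF CF Cphi.
  assert (Ex : forall a b, ex_RInt phi a b)
    by (intros a b; apply (ex_RInt_continuous (V := R_CompleteNormedModule)); auto).
  assert (HI : forall t, is_derive (RInt phi u) t (phi t)).
  { intros t; apply (is_derive_RInt (V := R_NormedModule) phi (RInt phi u) u t); [|auto].
    apply filter_forall; intros s; apply (RInt_correct (V := R_CompleteNormedModule)), Ex. }
  destruct (MVT_gen (fun t => F t - RInt phi u t) u v (fun _ => 0)) as (x & _ & Hx).
  - rewrite Rmin_left, Rmax_right by lra; intros t Ht.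
    replace 0 with (minus (phi t) (phi t)) by (unfold minus, plus, opp; simpl; ring).
    apply (is_derive_minus (K := R_AbsRing) (V := R_NormedModule)); auto.
  - rewrite Rmin_left, Rmax_right by lra; intros t Ht.
    apply continuity_pt_filterlim.
    apply (continuous_minus (V := R_NormedModule)); [auto|].
    apply (ex_derive_continuous (V := R_NormedModule)); eexists; apply HI.
  - assert (E : RInt phi u u = 0) by (apply (RInt_point (V := R_CompleteNormedModule))).
    replace (F v - F u) with (RInt phi u v) by (rewrite E in Hx; lra).
    apply (RInt_correct (V := R_CompleteNormedModule)), Ex.
Qed.

Lemma is_derive_components (f : R -> C) (t : R) (l : C) :
  is_derive (K := R_AbsRing) (V := C_R_NormedModule) f t l ->
  is_derive (fun s => fst (f s)) t (fst l) /\ is_derive (fun s => snd (f s)) t (snd l).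
Proof.
  intros H; split.
  - apply (filterdiff_ext_lin (fun s => fst (f s)) (fun y => fst (scal (V := C_R_NormedModule) y l))).
    + apply (filterdiff_comp' f (fun z : C_R_NormedModule => fst z) t _ fst); [exact H|].
      apply (filterdiff_linear (V := R_NormedModule)).
      apply (is_linear_fst (U := R_NormedModule) (V := R_NormedModule)).
    + intros y; reflexivity.
  - apply (filterdiff_ext_lin (fun s => snd (f s)) (fun y => snd (scal (V := C_R_NormedModule) y l))).
    + apply (filterdiff_comp' f (fun z : C_R_NormedModule => snd z) t _ snd); [exact H|].
      apply (filterdiff_linear (V := R_NormedModule)).
      apply (is_linear_snd (U := R_NormedModule) (V := R_NormedModule)).
    + intros y; reflexivity.
Qed.

Lemma velocity_derive (c : R -> C) (t : R) (l : C) :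
  is_derive (K := R_AbsRing) (V := C_R_NormedModule) c t l -> velocity c t = l.
Proof.
  intros H; apply is_derive_components in H as [H1 H2]; unfold velocity.
  apply is_derive_unique in H1; apply is_derive_unique in H2.
  destruct l as [l1 l2]; simpl in H1, H2; now f_equal.
Qed.

Lemma is_linear_Cmult (k : C) :
  is_linear (U := C_R_NormedModule) (V := C_R_NormedModule) (fun z => Cmult k z).
Proof.
  split.
  - intros x y; change (k * (x + y) = k * x + k * y)%C; ring.
  - intros a x; rewrite !C_R_scal; match goal with |- @eq _ ?u ?v => change (@eq C u v) end; ring.
  - exists (Cmod k + 1); split; [pose proof (Cmod_ge_0 k); lra|].
    intros x; rewrite !C_R_norm, Cmod_mult.
    pose proof (Cmod_ge_0 x); nra.
Qed.

(** The chain rule for a complex derivative after a real one: the complex differential enters as the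
    real-linear map of multiplication by [k]. *)
Lemma is_derive_comp_approx (F : C -> C) (k : C) (c : R -> C) (t : R) (l : C) :
  (forall eps, 0 < eps -> exists del, 0 < del /\ forall u, Cmod (u - c t) < del ->
     Cmod (F u - F (c t) - k * (u - c t)) <= eps * Cmod (u - c t)) ->
  is_derive (K := R_AbsRing) (V := C_R_NormedModule) c t l ->
  is_derive (K := R_AbsRing) (V := C_R_NormedModule) (fun s => F (c s)) t (k * l)%C.
Proof.
  intros HF Hc.
  apply (filterdiff_ext_lin (U := R_NormedModule) (V := C_R_NormedModule) (fun s => F (c s))
    (fun y => Cmult k (scal (V := C_R_NormedModule) y l))).
  - apply (filterdiff_comp' (U := R_NormedModule) (V := C_R_NormedModule)
      (W := C_R_NormedModule) c F t _ (fun z => Cmult k z)); [exact Hc|].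
    split; [apply is_linear_Cmult|].
    intros x Hx eps.
    apply (is_filter_lim_locally_unique (V := C_R_NormedModule)) in Hx; subst x.
    apply locally_Cmod; destruct (HF eps (cond_pos eps)) as (del & Hdel & H).
    exists del; split; [exact Hdel|]; intros u Hu; rewrite !C_R_norm; apply (H u Hu).
  - intros y; rewrite !C_R_scal; match goal with |- @eq _ ?u ?v => change (@eq C u v) end; ring.
Qed.

(** An induction principle over the arcs met by [[u, v]]. The index of [P] counts arcs: predicates
    that ignore it give additivity, and predicates linear in it give bounds proportional to [d].
    Break points may be infinite, whereas [u] and [v] are real. *)
Lemma arc_chain (P : nat -> R -> R -> Prop) (p : nat -> Rbar) (d : nat) :
  (forall u, P O u u) -> (forall n u v, P n u v -> P (S n) u v) ->
  (forall n u m v, u <= m <= v -> P n u m -> P 1%nat m v -> P (S n) u v) ->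
  (forall i u v, (i < d)%nat -> u <= v -> in_dom (p i) (p (S i)) u ->
     in_dom (p i) (p (S i)) v -> P 1%nat u v) ->
  forall u v, u <= v -> in_dom (p O) (p d) u -> in_dom (p O) (p d) v -> P d u v.
Proof.
  intros H0 Hmono Hcat; induction d as [|d IH]; intros Harc u v Huv Hu Hv.
  - replace v with u; [apply H0|].
    destruct Hu as [Hu1 Hu2], Hv as [Hv1 Hv2].
    destruct (p O) as [x| |]; simpl in *; try contradiction; lra.
  - assert (Hn : forall n, P n u u) by (induction n; auto).
    assert (IH' := IH (fun i x y Hi => Harc i x y (Nat.lt_lt_succ_r _ _ Hi))).
    destruct Hu as [Hu1 Hu2], Hv as [Hv1 Hv2].
    destruct (Rbar_le_dec (Finite v) (p d)) as [Hvd|Hvd].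
    + apply Hmono, IH'; [exact Huv | split | split]; auto.
      apply Rbar_le_trans with (Finite v); [exact Huv | exact Hvd].
    + apply Rbar_not_le_lt, Rbar_lt_le in Hvd.
      destruct (Rbar_le_dec (p d) (Finite u)) as [Hdu|Hdu].
      (* The interval meets only the last arc; the earlier arcs are represented by the degenerate
         interval at [u]. *)
      * apply (Hcat _ _ u); [lra | apply Hn|].
        apply (Harc d); [lia | exact Huv | split | split]; auto.
      * apply Rbar_not_le_lt, Rbar_lt_le in Hdu.
        (* A break point between two reals is finite, so the interval can be cut there. *)
        destruct (p d) as [m| |] eqn:Em; simpl in Hvd, Hdu; try contradiction.
        apply (Hcat _ _ m); [lra | |].
        -- apply IH'; [exact Hdu | split | split]; auto; try apply Rle_refl.
           apply Rbar_le_trans with (Finite u); [exact Hu1 | exact Hdu].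
        -- apply (Harc d); [lia | exact Hvd | split | split]; try rewrite Em.
           ++ apply Rle_refl.
           ++ apply Rbar_le_trans with (Finite v); [exact Hvd | exact Hv2].
           ++ exact Hvd.
           ++ exact Hv2.
Qed.

Lemma is_RInt_arc (g : C -> C) (z0 : C) (e : R) (c : R -> C) (p q : Rbar) (D : R -> C) (u v : R) :
  holo_on g (disc z0 e) -> C1_arc c p q D -> u <= v -> in_dom p q u -> in_dom p q v ->
  (forall t, u <= t <= v -> disc z0 e (c t)) ->
  is_RIntC (fun t => g (c t) * velocity c t)%C u v
    (local_primitive g z0 (c v) - local_primitive g z0 (c u))%C.
Proof.
  intros Hg (Cc & CD & Dc) Huv Hu Hv Hdisc.
  assert (HD : forall s, u <= s <= v -> in_dom p q s).
  { intros s Hs; split.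
    - apply Rbar_le_trans with (Finite u); [apply Hu | apply Hs].
    - apply Rbar_le_trans with (Finite v); [apply Hs | apply Hv]. }
  assert (Kc := continuous_clamp c _ u v Huv HD Cc).
  assert (KD := continuous_clamp D _ u v Huv HD CD).
  set (F := local_primitive g z0).
  assert (HF : forall z, disc z0 e z -> forall eps, 0 < eps -> exists del, 0 < del /\
     forall w, Cmod (w - z) < del -> Cmod (F w - F z - g z * (w - z)) <= eps * Cmod (w - z))
    by (intros; now apply (local_primitive_approx g z0 e Hg)).
  set (Phi := fun t => F (c (clamp u v t))).
  set (phi := fun t => (g (c (clamp u v t)) * D (clamp u v t))%C).
  assert (Kphi : forall t, continuous (U := C_UniformSpace) phi t).
  { intros t.
    assert (K1 : continuous (U := C_UniformSpace) (fun s => g (c (clamp u v s))) t).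
    { apply (continuous_comp_Ccont g (fun s => c (clamp u v s))); [apply Kc|].
      apply Cdiff_cont, Hg, Hdisc, clamp_in, Huv. }
    apply filterlim_Cmult; [apply locally_filter | exact K1 | apply KD]. }
  assert (KPhi : forall t, continuous (U := C_UniformSpace) Phi t).
  { intros t; apply (continuous_comp_Ccont F (fun s => c (clamp u v s))); [apply Kc|].
    apply Cdiff_cont, Cdiff_iff; exists (g (c (clamp u v t))).
    apply HF, Hdisc, clamp_in, Huv. }
  assert (DPhi : forall t, u < t < v ->
    is_derive (K := R_AbsRing) (V := C_R_NormedModule) Phi t (phi t)).
  { intros t Ht; apply (is_derive_ext_loc (fun s => F (c s))).
    - exists (mkposreal (Rmin (t - u) (v - t)) ltac:(apply Rmin_pos; lra)).
      intros s Hs; change (Rabs (s - t) < Rmin (t - u) (v - t)) in Hs.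
      apply Rmin_Rgt in Hs as [Hs1 Hs2].
      apply Rgt_lt, Rabs_lt_between in Hs1; apply Rgt_lt, Rabs_lt_between in Hs2.
      unfold Phi; rewrite clamp_id; [reflexivity | lra].
    - unfold phi; rewrite clamp_id by lra.
      apply (is_derive_comp_approx F (g (c t)) c t (D t)).
      + apply HF, Hdisc; lra.
      + apply Dc; [apply Rbar_le_lt_trans with (Finite u) | apply Rbar_lt_le_trans with (Finite v)];
          [apply Hu | apply Ht | apply Ht | apply Hv]. }
  assert (H : is_RIntC phi u v (Phi v - Phi u)%C).
  { apply is_RInt_C; split.
    - apply (ftc_open_interval (fun t => fst (Phi t)) (fun t => fst (phi t)) u v Huv).
      + intros t Ht; apply (is_derive_components _ _ _ (DPhi t Ht)).
      + intros t _; apply (continuous_comp Phi fst); [apply KPhi | apply continuous_fst].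
      + intros t; apply (continuous_comp phi fst); [apply Kphi | apply continuous_fst].
    - apply (ftc_open_interval (fun t => snd (Phi t)) (fun t => snd (phi t)) u v Huv).
      + intros t Ht; apply (is_derive_components _ _ _ (DPhi t Ht)).
      + intros t _; apply (continuous_comp Phi snd); [apply KPhi | apply continuous_snd].
      + intros t; apply (continuous_comp phi snd); [apply Kphi | apply continuous_snd]. }
  unfold Phi in H; rewrite !clamp_id in H by lra.
  eapply (is_RInt_ext (V := C_R_NormedModule)); [|exact H].
  (* Only interior parameters are compared. At the ends [D] is a one-sided derivative and
     [velocity c] may take another value. *)
  rewrite Rmin_left, Rmax_right by lra; intros t Ht.
  unfold phi; rewrite clamp_id by lra; f_equal; symmetry; apply velocity_derive, Dc;
    [apply Rbar_le_lt_trans with (Finite u) | apply Rbar_lt_le_trans with (Finite v)];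
    [apply Hu | apply Ht | apply Ht | apply Hv].
Qed.

(* Unlike [piecewise_C1], this does not ask that the arcs end exactly at the
   given parameters, so that an arc decomposition of a non-compact curve
   provides it without being cut. *)
Definition piecewise_arcs (c : R -> C) (ta tb : Rbar) : Prop :=
  forall u v, in_dom ta tb u -> in_dom ta tb v -> u < v ->
    exists ta' tb' d p D, arc_decomposition c ta' tb' d p D /\
      in_dom ta' tb' u /\ in_dom ta' tb' v.

Lemma piecewise_C1_arcs (c : R -> C) (ta tb : Rbar) :
  piecewise_C1 c ta tb -> piecewise_arcs c ta tb.
Proof.
  intros H u v Hu Hv Huv; destruct (H u v Hu Hv Huv) as (d & p & D & Hd).
  exists (Finite u), (Finite v), d, p, D; split; [exact Hd|].
  repeat split; simpl; lra.
Qed.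

Lemma arc_decomposition_arcs (c : R -> C) (ta tb : Rbar) d p D :
  arc_decomposition c ta tb d p D -> piecewise_arcs c ta tb.
Proof. intros H u v Hu Hv _; exists ta, tb, d, p, D; auto. Qed.

(** Inside a disc of holomorphy the integral depends only on the end points, so the chord can
    replace the path. Chords also make sense along curves without a velocity. *)
Lemma is_RInt_path (g : C -> C) (z0 : C) (e : R) (c : R -> C) (ta tb : Rbar) (u v : R) :
  holo_on g (disc z0 e) -> piecewise_arcs c ta tb -> u <= v -> in_dom ta tb u -> in_dom ta tb v ->
  (forall t, u <= t <= v -> disc z0 e (c t)) ->
  is_RIntC (fun t => g (c t) * velocity c t)%C u v (seg_int g (c u) (c v)).
Proof.
  intros Hg Hc Huv Hu Hv Hdisc.
  rewrite (seg_int_primitive g z0 e Hg) by (apply Hdisc; lra).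
  destruct Huv as [Huv|<-].
  2: { replace (local_primitive g z0 (c u) - local_primitive g z0 (c u))%C
         with (zero : C_R_NormedModule)
         by (change (@eq C (RtoC 0) (local_primitive g z0 (c u) - local_primitive g z0 (c u))%C); ring).
       apply (is_RInt_point (V := C_R_NormedModule)). }
  destruct (Hc u v Hu Hv Huv)
    as (ta' & tb' & d & p & D & (Hp0 & Hpd & Harcs) & Du & Dv).
  set (Q := fun t => local_primitive g z0 (c t)).
  assert (H := arc_chain (fun _ x y => u <= x -> y <= v ->
    is_RIntC (fun t => g (c t) * velocity c t)%C x y (Q y - Q x)%C) p d).
  apply H; try (rewrite Hp0, Hpd; assumption); try lra.
  - intros x _ _.
    replace (Q x - Q x)%C with (zero : C_R_NormedModule)
      by (change (@eq C (RtoC 0) (Q x - Q x)%C); ring).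
    apply (is_RInt_point (V := C_R_NormedModule)).
  - auto.
  - intros n x m y Hm H1 H2 Hx Hy.
    replace (Q y - Q x)%C with ((Q m - Q x) + (Q y - Q m))%C by ring.
    apply (is_RInt_Chasles (V := C_R_NormedModule) _ x m y); [apply H1 | apply H2]; lra.
  - intros i x y Hi Hxy Dx Dy Hx Hy.
    destruct (Harcs i Hi) as [_ Ha].
    apply (is_RInt_arc g z0 e c _ _ (D i)) with (1 := Hg) (2 := Ha); auto.
    intros t Ht; apply Hdisc; lra.
Qed.

(** * Homotopies of paths *)

(** The substitute for a contour integral along a curve that is merely continuous, sampled at the
    points [x k]. *)
Fixpoint polygon_int (g : C -> C) (x : nat -> C) (n : nat) : C :=
  match n with
  | O => RtoC 0
  | S k => (polygon_int g x k + seg_int g (x k) (x (S k)))%C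
  end.

Lemma polygon_int_ext (g : C -> C) (x y : nat -> C) (n : nat) :
  (forall k, (k <= n)%nat -> x k = y k) -> polygon_int g x n = polygon_int g y n.
Proof.
  induction n as [|n IH]; intros H; simpl; [reflexivity|].
  rewrite IH, (H n), (H (S n)) by (intros; auto with arith); reflexivity.
Qed.

Lemma seg_int_point (g : C -> C) (x : C) : seg_int g x x = RtoC 0.
Proof.
  apply (is_RInt_unique (V := C_R_CompleteNormedModule)).
  apply (is_RInt_ext (V := C_R_NormedModule) (fun _ => zero)).
  - intros t _; unfold seg; change (@eq C (RtoC 0) (g (x + t * (x - x)) * (x - x))%C); ring.
  - replace (RtoC 0) with (scal (V := C_R_NormedModule) (1 - 0) zero)
      by (rewrite C_R_scal; change (@eq C (RtoC (1 - 0) * RtoC 0)%C (RtoC 0)); ring).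
    apply (is_RInt_const (V := C_R_NormedModule)).
Qed.

Lemma polygon_int_const (g : C -> C) (x : nat -> C) (n : nat) :
  (forall k, (k <= n)%nat -> x k = x O) -> polygon_int g x n = RtoC 0.
Proof.
  induction n as [|n IH]; intros H; simpl; [reflexivity|].
  rewrite IH, (H n), (H (S n)), seg_int_point by (intros; auto with arith); ring.
Qed.

Definition in_common_disc (g : C -> C) (P : C -> Prop) : Prop :=
  exists z0 e, holo_on g (disc z0 e) /\ forall z, P z -> disc z0 e z.

Lemma is_RInt_polygon (g : C -> C) (c : R -> C) (ta tb : Rbar) (t : nat -> R) (n : nat) :
  piecewise_arcs c ta tb ->
  (forall k, (k < n)%nat -> t k <= t (S k)) ->
  (forall k, (k <= n)%nat -> in_dom ta tb (t k)) ->
  (forall k, (k < n)%nat ->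
     in_common_disc g (fun z => exists s, t k <= s <= t (S k) /\ z = c s)) ->
  is_RIntC (fun s => g (c s) * velocity c s)%C (t O) (t n) (polygon_int g (fun k => c (t k)) n).
Proof.
  intros Hc; induction n as [|n IH]; intros Ht Hdom Hdisc; simpl.
  - apply (is_RInt_point (V := C_R_NormedModule)).
  - apply (is_RInt_Chasles (V := C_R_NormedModule) _ (t O) (t n) (t (S n))).
    + apply IH; auto with arith.
    + destruct (Hdisc n) as (z0 & e & Hg & Hin); [lia|].
      apply (is_RInt_path g z0 e c ta tb); auto with arith.
      intros s Hs; apply Hin; now exists s.
Qed.

Definition unit_rect (u v : R) (q : R * R) : Prop :=
  0 <= fst q <= 1 /\ u <= snd q <= v.

Section Grid.

Variables (g : C -> C) (H : R -> R -> C) (u v : R).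
Hypothesis Huv : u <= v.
Hypothesis Hcont : continuous_on (T := prod_UniformSpace R_UniformSpace R_UniformSpace)
  (U := C_UniformSpace) (unit_rect u v) (fun q => H (fst q) (snd q)).
Hypothesis Hholo : forall x y, 0 <= x <= 1 -> u <= y <= v ->
  exists e, 0 < e /\ holo_on g (disc (H x y) e).

Definition cell_in_disc (x y h k : R) : Prop :=
  in_common_disc g (fun z => exists x' y', 0 <= x' <= 1 /\ u <= y' <= v /\
    Rabs (x' - x) <= h /\ Rabs (y' - y) <= k /\ z = H x' y').

(** A Lebesgue number argument: the compact rectangle is covered by neighbourhoods that [H] maps
    into discs of holomorphy, and one mesh serves all cells. *)
Lemma fine_grid : exists N : nat, (0 < N)%nat /\
  forall x y, 0 <= x <= 1 -> u <= y <= v -> cell_in_disc x y (/ INR N) ((v - u) / INR N).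
Proof.
  assert (Hloc : forall q : R * R, exists d : posreal, unit_rect u v q ->
    exists e, holo_on g (disc (H (fst q) (snd q)) e) /\
      forall x' y', unit_rect u v (x', y') -> Rabs (x' - fst q) < 2 * d ->
        Rabs (y' - snd q) < 2 * d -> disc (H (fst q) (snd q)) e (H x' y')).
  { intros [a b]; destruct (classic (unit_rect u v (a, b))) as [Hq|Hq];
      [|exists (mkposreal 1 Rlt_0_1); intros; contradiction].
    destruct (Hholo a b) as (e & He & Hg); [apply Hq | apply Hq|].
    assert (C := Hcont (a, b) Hq); rewrite filterlim_Cmod in C
      by (apply within_filter, locally_filter).
    destruct (C e He) as (d & Hd); simpl in Hd.
    (* Halved, because a point of a cell is reached in two steps: from the centre of the covering
       neighbourhood to [(x, y)], then across the cell, each at most this radius. *)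
    exists (mkposreal (d / 2) ltac:(pose proof (cond_pos d); lra)); intros _.
    exists e; split; [exact Hg|]; simpl.
    intros x' y' Hq' Hx Hy; apply (Hd (x', y')); [|exact Hq'].
    split; simpl; [change (Rabs (x' - a) < d) | change (Rabs (y' - b) < d)]; lra. }
  apply choice in Hloc as (delta & Hdelta).
  destruct (compactness_value_2d 0 1 u v (fun a b => delta (a, b))) as (d & Hd).
  (* The numerator dominates both 1 and [v - u], so both mesh widths fall below [d]. *)
  destruct (nfloor_ex ((1 + (v - u)) / d)) as (n & _ & Hn).
  { apply Rdiv_le_0_compat; [lra | apply cond_pos]. }
  assert (Hn0 : 0 < INR (S n)) by apply lt_0_INR, Nat.lt_0_succ.
  assert (Hnd : 1 + (v - u) < INR (S n) * d).
  { rewrite S_INR; apply Rlt_div_l; [apply cond_pos | exact Hn]. }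
  exists (S n); split; [lia|]; intros x y Hx Hy.
  assert (Ex := NNPP _ (Hd x y Hx Hy)).
  destruct Ex as (a & b & Ha & Hb & Hxa & Hyb & Hle).
  destruct (Hdelta (a, b) (conj Ha Hb)) as (e & Hg & Hin).
  exists (H a b), e; split; [exact Hg|].
  intros z (x' & y' & Hx' & Hy' & Hxx & Hyy & ->).
  assert (B1 : / INR (S n) < d).
  { apply Rmult_lt_reg_l with (INR (S n)); [exact Hn0|]; rewrite Rinv_r by lra; lra. }
  assert (B2 : (v - u) / INR (S n) < d) by (apply Rlt_div_l; lra).
  apply (Hin x' y' (conj Hx' Hy')); simpl.
  - replace (x' - a) with ((x' - x) + (x - a)) by ring.
    eapply Rle_lt_trans; [apply Rabs_triang | lra].
  - replace (y' - b) with ((y' - y) + (y - b)) by ring.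
    eapply Rle_lt_trans; [apply Rabs_triang | lra].
Qed.

Section Sums.

Variable N : nat.
Hypothesis HN : (0 < N)%nat.
Hypothesis Hcells : forall x y, 0 <= x <= 1 -> u <= y <= v ->
  cell_in_disc x y (/ INR N) ((v - u) / INR N).

Definition row (i : nat) : R := INR i / INR N.
Definition col (j : nat) : R := u + INR j * ((v - u) / INR N).
Definition node (i j : nat) : C := H (row i) (col j).

Lemma INR_N : 0 < INR N.
Proof. now apply lt_0_INR. Qed.

Lemma row_in (i : nat) : (i <= N)%nat -> 0 <= row i <= 1.
Proof.
  intros Hi; pose proof INR_N; unfold row; split.
  - apply Rdiv_le_0_compat; [apply pos_INR | assumption].
  - apply Rle_div_l; [assumption|]; rewrite Rmult_1_l; now apply le_INR.
Qed.

Lemma row_step (i : nat) : row (S i) = row i + / INR N.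
Proof. pose proof INR_N; unfold row; rewrite S_INR; field; lra. Qed.

Lemma col_in (j : nat) : (j <= N)%nat -> u <= col j <= v.
Proof.
  intros Hj; unfold col.
  replace (INR j * ((v - u) / INR N)) with (row j * (v - u))
    by (unfold row; field; pose proof INR_N; lra).
  pose proof (row_in j Hj); nra.
Qed.

Lemma col_step (j : nat) : col (S j) = col j + (v - u) / INR N.
Proof. unfold col; rewrite S_INR; ring. Qed.

Lemma row_0 : row 0 = 0. Proof. unfold row; simpl; unfold Rdiv; ring. Qed.
Lemma row_N : row N = 1. Proof. unfold row; field; pose proof INR_N; lra. Qed.
Lemma col_0 : col 0 = u. Proof. unfold col; simpl; ring. Qed.
Lemma col_N : col N = v. Proof. unfold col; field; pose proof INR_N; lra. Qed.

Lemma step_pos : 0 < / INR N /\ 0 <= (v - u) / INR N.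
Proof.
  pose proof INR_N; split; [now apply Rinv_0_lt_compat|].
  apply Rdiv_le_0_compat; lra.
Qed.

(** The four corners lie in one disc on which [g] has a primitive, so both ways from one corner to
    the opposite corner give the same increment. *)
Lemma cell_identity (i j : nat) : (i < N)%nat -> (j < N)%nat ->
  (seg_int g (node i j) (node i (S j)) + seg_int g (node i (S j)) (node (S i) (S j)) =
   seg_int g (node i j) (node (S i) j) + seg_int g (node (S i) j) (node (S i) (S j)))%C.
Proof.
  intros Hi Hj.
  assert (Ri := row_in i ltac:(lia)); assert (Rj := col_in j ltac:(lia)).
  assert (Ri' := row_in (S i) Hi); assert (Rj' := col_in (S j) Hj).
  destruct (Hcells (row i) (col j) Ri Rj) as (z0 & e & Hg & Hin).
  pose proof step_pos as [P1 P2].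
  assert (A : forall i' j', 0 <= row i' <= 1 -> u <= col j' <= v ->
    (row i' = row i \/ row i' = row i + / INR N) ->
    (col j' = col j \/ col j' = col j + (v - u) / INR N) -> disc z0 e (node i' j')).
  { intros i' j' H1 H2 H3 H4; apply Hin; exists (row i'), (col j').
    repeat split; try tauto.
    - destruct H3 as [->| ->]; [replace (row i - row i) with 0 by ring|
        replace (row i + / INR N - row i) with (/ INR N) by ring];
        rewrite Rabs_pos_eq; lra.
    - destruct H4 as [->| ->]; [replace (col j - col j) with 0 by ring|
        replace (col j + (v - u) / INR N - col j) with ((v - u) / INR N) by ring];
        rewrite Rabs_pos_eq; lra. }
  assert (A00 := A i j Ri Rj ltac:(auto) ltac:(auto)).
  assert (A01 := A i (S j) Ri Rj' ltac:(auto) ltac:(right; apply col_step)).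
  assert (A10 := A (S i) j Ri' Rj ltac:(right; apply row_step) ltac:(auto)).
  assert (A11 := A (S i) (S j) Ri' Rj' ltac:(right; apply row_step) ltac:(right; apply col_step)).
  rewrite (seg_int_primitive g z0 e Hg (node i j) (node i (S j))),
    (seg_int_primitive g z0 e Hg (node i (S j)) (node (S i) (S j))),
    (seg_int_primitive g z0 e Hg (node i j) (node (S i) j)),
    (seg_int_primitive g z0 e Hg (node (S i) j) (node (S i) (S j))) by assumption.
  ring.
Qed.

Lemma strip_identity (i n : nat) : (i < N)%nat -> (n <= N)%nat ->
  (polygon_int g (node i) n + seg_int g (node i n) (node (S i) n) =
   seg_int g (node i 0) (node (S i) 0) + polygon_int g (node (S i)) n)%C.
Proof.
  intros Hi; induction n as [|n IH]; intros Hn; simpl; [ring|].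
  specialize (IH ltac:(lia)); assert (E := cell_identity i n Hi Hn).
  rewrite <- Cplus_assoc, E, Cplus_assoc, IH; ring.
Qed.

Lemma grid_identity (m : nat) : (m <= N)%nat ->
  (polygon_int g (node 0) N + polygon_int g (fun i => node i N) m =
   polygon_int g (fun i => node i 0) m + polygon_int g (node m) N)%C.
Proof.
  induction m as [|m IH]; intros Hm; simpl; [ring|].
  specialize (IH ltac:(lia)); assert (E := strip_identity m N Hm ltac:(lia)).
  rewrite Cplus_assoc, IH, <- Cplus_assoc, E; ring.
Qed.

(** The curve [c] is kept apart from [H (row i)]: they agree on [[u, v]], while the smoothness and
    [velocity] are those of [c]. For the first and last rows [c] is one of the two deformed
    curves. *)
Lemma is_RInt_row (c : R -> C) (ta tb : Rbar) (i : nat) : (i <= N)%nat ->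
  in_dom ta tb u -> in_dom ta tb v -> piecewise_arcs c ta tb ->
  (forall t, u <= t <= v -> c t = H (row i) t) ->
  is_RIntC (fun t => g (c t) * velocity c t)%C u v (polygon_int g (node i) N).
Proof.
  intros Hi Hu Hv Hc Ec.
  cut (is_RIntC (fun t => g (c t) * velocity c t)%C (col 0) (col N) (polygon_int g (node i) N)).
  { rewrite col_0, col_N; auto. }
  rewrite (polygon_int_ext g (node i) (fun k => c (col k)))
    by (intros k Hk; unfold node; symmetry; apply Ec, col_in, Hk).
  pose proof step_pos as [P1 P2].
  apply (is_RInt_polygon g c ta tb); auto.
  - intros k Hk; rewrite col_step; lra.
  - intros k Hk; pose proof (col_in k Hk) as [B1 B2]; split.
    + apply Rbar_le_trans with (Finite u); [apply Hu | exact B1].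
    + apply Rbar_le_trans with (Finite v); [exact B2 | apply Hv].
  - intros k Hk.
    destruct (Hcells (row i) (col k) (row_in i Hi) (col_in k ltac:(lia)))
      as (z0 & e & Hg & Hin).
    exists z0, e; split; [exact Hg|]; intros z (s & Hs & ->).
    pose proof (col_in k ltac:(lia)); pose proof (col_in (S k) Hk).
    assert (Hs' := Hs); rewrite col_step in Hs'.
    apply Hin; exists (row i), s.
    repeat split; try (apply row_in; assumption); try lra.
    + replace (row i - row i) with 0 by ring; rewrite Rabs_R0; lra.
    + rewrite Rabs_pos_eq; lra.
    + apply Ec; lra.
Qed.

Lemma is_RInt_col (j : nat) : (j <= N)%nat ->
  piecewise_arcs (fun s => H s (col j)) (Finite 0) (Finite 1) ->
  is_RIntC (fun s => g (H s (col j)) * velocity (fun s => H s (col j)) s)%C 0 1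
    (polygon_int g (fun i => node i j) N).
Proof.
  intros Hj Hc.
  cut (is_RIntC (fun s => g (H s (col j)) * velocity (fun s => H s (col j)) s)%C (row 0) (row N)
    (polygon_int g (fun i => node i j) N)).
  { rewrite row_0, row_N; auto. }
  pose proof step_pos as [P1 P2].
  apply (is_RInt_polygon g (fun s => H s (col j)) (Finite 0) (Finite 1) row); auto.
  - intros k Hk; rewrite row_step; lra.
  - intros k Hk; pose proof (row_in k Hk) as [B1 B2]; split; assumption.
  - intros k Hk.
    destruct (Hcells (row k) (col j) (row_in k ltac:(lia)) (col_in j Hj))
      as (z0 & e & Hg & Hin).
    exists z0, e; split; [exact Hg|]; intros z (s & Hs & ->).
    pose proof (row_in k ltac:(lia)); pose proof (row_in (S k) Hk).
    apply Hin; exists s, (col j).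
    repeat split; try (apply col_in; assumption); try lra.
    + rewrite row_step in Hs; rewrite Rabs_pos_eq; lra.
    + replace (col j - col j) with 0 by ring; rewrite Rabs_R0; lra.
Qed.

End Sums.

(** The sides are exported as numbers because the grid sums exist for every continuous [H], smooth
    side or not. The last three clauses serve loops, whose two transversals coincide, and ends that
    stay fixed. *)
Theorem homotopy_rectangle : exists R0 R1 Cu Cv : C,
  (R0 + Cv = Cu + R1)%C /\
  (forall c ta tb, in_dom ta tb u -> in_dom ta tb v -> piecewise_arcs c ta tb ->
     (forall t, u <= t <= v -> c t = H 0 t) ->
     is_RIntC (fun t => g (c t) * velocity c t)%C u v R0) /\
  (forall c ta tb, in_dom ta tb u -> in_dom ta tb v -> piecewise_arcs c ta tb ->
     (forall t, u <= t <= v -> c t = H 1 t) ->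
     is_RIntC (fun t => g (c t) * velocity c t)%C u v R1) /\
  (piecewise_arcs (fun s => H s u) (Finite 0) (Finite 1) ->
     is_RIntC (fun s => g (H s u) * velocity (fun s => H s u) s)%C 0 1 Cu) /\
  (piecewise_arcs (fun s => H s v) (Finite 0) (Finite 1) ->
     is_RIntC (fun s => g (H s v) * velocity (fun s => H s v) s)%C 0 1 Cv) /\
  ((forall s, 0 <= s <= 1 -> H s u = H s v) -> Cu = Cv) /\
  ((forall s, 0 <= s <= 1 -> H s u = H 0 u) -> Cu = RtoC 0) /\
  ((forall s, 0 <= s <= 1 -> H s v = H 0 v) -> Cv = RtoC 0).
Proof.
  destruct fine_grid as (N & HN & Hcells).
  exists (polygon_int g (node N 0) N), (polygon_int g (node N N) N),
    (polygon_int g (fun i => node N i 0) N), (polygon_int g (fun i => node N i N) N).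
  split; [now apply grid_identity|].
  split; [|split; [|split; [|split; [|split; [|split]]]]].
  - intros c ta tb Hu Hv Hc Ec; apply (is_RInt_row N HN Hcells c ta tb); auto with arith.
    rewrite row_0; exact Ec.
  - intros c ta tb Hu Hv Hc Ec; apply (is_RInt_row N HN Hcells c ta tb); auto.
    rewrite row_N by exact HN; exact Ec.
  - intros Hc; assert (A := is_RInt_col N HN Hcells 0 ltac:(lia)).
    rewrite col_0 in A; exact (A Hc).
  - intros Hc; assert (A := is_RInt_col N HN Hcells N ltac:(lia)).
    rewrite col_N in A by exact HN; exact (A Hc).
  - intros E; apply polygon_int_ext; intros k Hk; unfold node.
    rewrite col_0, col_N by exact HN; now apply E, row_in.
  - intros E; apply polygon_int_const; intros k Hk; unfold node.
    rewrite col_0, row_0; now apply E, row_in.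
  - intros E; apply polygon_int_const; intros k Hk; unfold node.
    rewrite col_N, row_0 by exact HN; now apply E, row_in.
Qed.

End Grid.

(** * Deformation of improper contour integrals *)

Local Instance end_filter_proper (e : Rbar) : ProperFilter (end_filter e).
Proof. destruct e; simpl; [apply at_point_filter | apply Rbar_locally_filter ..]. Qed.

Lemma is_RIntC_unique (f : R -> C) (a b : R) (l1 l2 : C) :
  is_RIntC f a b l1 -> is_RIntC f a b l2 -> l1 = l2.
Proof.
  intros H1 H2.
  apply (is_RInt_unique (V := C_R_CompleteNormedModule)) in H1.
  apply (is_RInt_unique (V := C_R_CompleteNormedModule)) in H2.
  now rewrite <- H1, <- H2.
Qed.

Lemma is_RInt_gen_Cmod (f : R -> C) (Fa Fb : (R -> Prop) -> Prop)
    {FFa : Filter Fa} {FFb : Filter Fb} (l : C) :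
  is_RInt_gen (V := C_R_NormedModule) f Fa Fb l <->
  forall eps, 0 < eps ->
    filter_prod Fa Fb (fun q => exists y, is_RIntC f (fst q) (snd q) y /\ Cmod (y - l) < eps).
Proof.
  split.
  - intros H eps Heps; apply (H (fun y => Cmod (y - l) < eps)).
    apply locally_Cmod; now exists eps.
  - intros H P HP; apply locally_Cmod in HP as (d & Hd & HP).
    unfold filtermapi; eapply filter_imp; [|exact (H d Hd)].
    intros q (y & Hy & Hl); exists y; auto.
Qed.

(** A finite end has a filter concentrated at the end itself, an infinite one lets the parameter
    pass any [m]. In both cases the truncations [[u, v]] are eventually non-degenerate and inside
    the domain. *)
Lemma ends_separated (ta tb : Rbar) : Rbar_lt ta tb -> exists m : R,
  end_filter ta (fun t => in_dom ta tb t /\ t < m) /\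
  end_filter tb (fun t => in_dom ta tb t /\ m < t).
Proof.
  intros H; destruct ta as [x| |], tb as [y| |]; simpl in *; try contradiction.
  - exists ((x + y) / 2); unfold at_point, in_dom; simpl; repeat split; lra.
  - exists (x + 1); unfold at_point, in_dom; simpl; split; [repeat split; lra|].
    exists (x + 1); intros t Ht; repeat split; lra.
  - exists (y - 1); unfold at_point, in_dom; simpl; split; [|repeat split; lra].
    exists (y - 1); intros t Ht; repeat split; lra.
  - exists 0; unfold in_dom; simpl; split; exists 0; intros t Ht; repeat split; lra.
Qed.

(** What is retained of a grid sum over a transversal: it is the integral if the transversal is
    piecewise smooth, and zero if the transversal is a single point. *)
Definition transversal_value (g : C -> C) (H : R -> R -> C) (t : R) (x : C) : Prop :=
  (piecewise_arcs (fun s => H s t) (Finite 0) (Finite 1) ->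
     is_RIntC (fun s => g (H s t) * velocity (fun s => H s t) s)%C 0 1 x) /\
  ((forall s, 0 <= s <= 1 -> H s t = H 0 t) -> x = RtoC 0).

(** The two clauses of [transversal_value] answer to the two kinds of end: at an infinite end the
    integral tends to 0 by assumption, at a finite end the boundary is fixed and the transversal
    degenerates. *)
Lemma transversal_small (g : C -> C) (H : R -> R -> C) (ta tb e : Rbar) :
  fixed_boundary (fun s => 0 <= s <= 1) H ta tb -> e = ta \/ e = tb ->
  negligible_end g H e -> forall eps, 0 < eps ->
  end_filter e (fun t => forall x, transversal_value g H t x -> Cmod x < eps).
Proof.
  intros Hfix He Hneg eps Heps.
  assert (Inf : Rbar_locally e (fun t => piecewise_C1 (fun s => H s t) (Finite 0) (Finite 1)) /\
      filterlim (fun t => contour_int g (fun s => H s t) (Finite 0) (Finite 1))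
        (Rbar_locally e) (locally (T := C_UniformSpace) (RtoC 0)) ->
    Rbar_locally e (fun t => forall x, transversal_value g H t x -> Cmod x < eps)).
  { intros [H1 H2]; rewrite filterlim_Cmod in H2 by apply Rbar_locally_filter.
    generalize (filter_and _ _ H1 (H2 eps Heps)); apply filter_imp.
    intros t [Ht1 Ht2] x [Hx _].
    apply piecewise_C1_arcs in Ht1; specialize (Hx Ht1).
    replace (contour_int g (fun s => H s t) (Finite 0) (Finite 1)) with x in Ht2.
    - replace (x - 0)%C with x in Ht2 by ring; exact Ht2.
    - symmetry; apply (is_RInt_gen_unique (V := C_R_CompleteNormedModule)).
      now apply (is_RInt_gen_at_point (V := C_R_NormedModule)). }
  destruct e as [y| |]; [|exact (Inf Hneg) | exact (Inf Hneg)].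
  intros x [_ Hx]; rewrite Hx, Cmod_0; [exact Heps|].
  intros s Hs; apply (Hfix y He); lra.
Qed.

(** On [[u, v]] the two integrals differ by the transversals [Cv - Cu], which vanish in the limit or
    cancel. Convergence along the new curve is thus a conclusion, not an assumption. *)
Theorem contour_deformation (Om : C -> Prop) (g : C -> C) (ta tb : Rbar)
    (G0 G1 : R -> C) (H : R -> R -> C) (l : C) :
  Rbar_lt ta tb ->
  (forall z, Om z -> exists e, 0 < e /\ holo_on g (disc z e)) ->
  deformation Om ta tb G0 G1 H ->
  (forall e, e = ta \/ e = tb -> negligible_end g H e) ->
  piecewise_arcs G0 ta tb -> piecewise_arcs G1 ta tb ->
  is_RInt_gen (V := C_R_NormedModule) (fun t => g (G0 t) * velocity G0 t)%C
    (end_filter ta) (end_filter tb) l ->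
  is_RInt_gen (V := C_R_NormedModule) (fun t => g (G1 t) * velocity G1 t)%C
    (end_filter ta) (end_filter tb) l.
Proof.
  intros Hlt Hg (HG & (Hcont & Hends) & HOm) Hneg P0 P1.
  rewrite !is_RInt_gen_Cmod by apply end_filter_proper; intros Hl eps Heps.
  assert (Key : forall u v y, in_dom ta tb u -> in_dom ta tb v -> u < v ->
    is_RIntC (fun t => g (G0 t) * velocity G0 t)%C u v y ->
    exists Cu Cv, transversal_value g H u Cu /\ transversal_value g H v Cv /\
      is_RIntC (fun t => g (G1 t) * velocity G1 t)%C u v (y + Cv - Cu)%C /\
      ((forall s, 0 <= s <= 1 -> H s u = H s v) -> Cu = Cv)).
  { intros u v y Hu Hv Huv Hy.
    assert (Sub : forall t, u <= t <= v -> in_dom ta tb t).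
    { intros t Ht; split.
      - apply Rbar_le_trans with (Finite u); [apply Hu | apply Ht].
      - apply Rbar_le_trans with (Finite v); [apply Ht | apply Hv]. }
    destruct (homotopy_rectangle g H u v) as (R0 & R1 & Cu & Cv & E & I0 & I1 & Iu & Iv & Eq & Eu & Ev).
    - lra.
    - intros [a b] Hq; unfold unit_rect in Hq; simpl in Hq.
      intros Q HQ; specialize (Hcont (a, b)); simpl in Hcont.
      assert (A := Hcont (conj (proj1 Hq) (Sub b (proj2 Hq))) Q HQ).
      unfold filtermap, within in *; revert A; apply filter_imp.
      intros [a' b'] A Hq'; apply A; split; [apply Hq' | apply Sub, Hq'].
    - intros x t Hx Ht; apply Hg, HOm; auto.
    - exists Cu, Cv; split; [split; assumption|]; split; [split; assumption|].
      split; [|exact Eq].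
      replace y with R0.
      + replace (R0 + Cv - Cu)%C with R1 by (rewrite E; ring).
        apply (I1 G1 ta tb); auto; intros t Ht; symmetry; apply HG; auto.
      + apply (is_RIntC_unique (fun t => g (G0 t) * velocity G0 t)%C u v); [|exact Hy].
        apply (I0 G0 ta tb); auto; intros t Ht; symmetry; apply HG; auto. }
  destruct (ends_separated ta tb Hlt) as (m & Sa & Sb).
  destruct Hends as [Hfix|(x & y & -> & -> & Hclosed)].
  - destruct (Hl (eps / 3)) as [Qa Qb HQa HQb HQ]; [lra|].
    assert (Ta := transversal_small g H ta tb ta Hfix (or_introl eq_refl)
      (Hneg ta (or_introl eq_refl)) (eps / 3) ltac:(lra)).
    assert (Tb := transversal_small g H ta tb tb Hfix (or_intror eq_refl)
      (Hneg tb (or_intror eq_refl)) (eps / 3) ltac:(lra)).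
    eapply Filter_prod;
      [exact (filter_and _ _ (filter_and _ _ HQa Sa) Ta)
      |exact (filter_and _ _ (filter_and _ _ HQb Sb) Tb)|].
    intros u v [[Hu1 [Hu2 Hu3]] Hu4] [[Hv1 [Hv2 Hv3]] Hv4]; simpl.
    destruct (HQ u v Hu1 Hv1) as (y & Hy & Hyl); simpl in Hy.
    destruct (Key u v y Hu2 Hv2 ltac:(lra) Hy) as (Cu & Cv & Vu & Vv & HI & _).
    exists (y + Cv - Cu)%C; split; [exact HI|].
    specialize (Hu4 Cu Vu); specialize (Hv4 Cv Vv).
    replace (y + Cv - Cu - l)%C with ((y - l) + (Cv - Cu))%C by ring.
    eapply Rle_lt_trans; [apply Cmod_triangle|].
    pose proof (Cmod_sub_le Cv Cu); lra.
  (* For loops the end point may move, so the transversals need not be small; but they are the same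
     curve, and both end filters are concentrated at a point. *)
  - destruct (Hl eps Heps) as [Qa Qb HQa HQb HQ].
    assert (Ea : end_filter (Finite x) (fun u => u = x)) by reflexivity.
    assert (Eb : end_filter (Finite y) (fun v => v = y)) by reflexivity.
    eapply Filter_prod;
      [exact (filter_and _ _ (filter_and _ _ HQa Sa) Ea)
      |exact (filter_and _ _ (filter_and _ _ HQb Sb) Eb)|].
    intros u v [[Hu1 [Hu2 Hu3]] ->] [[Hv1 [Hv2 Hv3]] ->]; simpl.
    destruct (HQ x y Hu1 Hv1) as (I & HI & HIl); simpl in HI.
    destruct (Key x y I Hu2 Hv2 ltac:(lra) HI) as (Cu & Cv & _ & _ & HI' & Heq).
    exists I; split; [|exact HIl].
    rewrite (Heq Hclosed) in HI'.
    replace I with (I + Cv - Cv)%C by ring; exact HI'.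
Qed.

(** * Holomorphy and linearity *)

Lemma ex_derive_Cdiff (f : C -> C) (z : C) :
  ex_derive (K := C_AbsRing) (V := C_NormedModule) f z <-> Cdiff f z.
Proof.
  rewrite Cdiff_iff; split.
  - intros (l & _ & H); exists l; intros eps Heps.
    destruct (H z (fun P HP => HP) (mkposreal eps Heps)) as (d & Hd).
    exists d; split; [apply cond_pos|]; intros u Hu.
    specialize (Hd u Hu).
    replace (l * (u - z))%C with ((u - z) * l)%C by ring; exact Hd.
  - intros (l & H); exists l; split; [apply (is_linear_scal_l (V := C_NormedModule))|].
    intros x Hx eps.
    apply (is_filter_lim_locally_unique (V := AbsRing_NormedModule C_AbsRing)) in Hx; subst x.
    destruct (H eps (cond_pos eps)) as (d & Hd & H').
    exists (mkposreal d Hd); intros u Hu; specialize (H' u Hu).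
    replace (l * (u - z))%C with ((u - z) * l)%C in H' by ring; exact H'.
Qed.

Definition holo_near (f : C -> C) (z : C) : Prop :=
  exists e, 0 < e /\ holo_on f (disc z e).

Lemma holomorphic_at_near (f : C -> C) (z : C) : holomorphic_at f z <-> holo_near f z.
Proof.
  unfold holomorphic_at; rewrite locally_Cmod; unfold holo_near, holo_on, disc.
  split; intros (e & He & H); exists e; split; auto; intros u Hu;
    apply ex_derive_Cdiff; auto.
Qed.

Lemma holo_near_mult (f g : C -> C) (z : C) :
  holo_near f z -> holo_near g z -> holo_near (fun u => f u * g u)%C z.
Proof.
  intros (e1 & He1 & H1) (e2 & He2 & H2).
  exists (Rmin e1 e2); split; [now apply Rmin_pos|]; intros u Hu; unfold disc in Hu.
  apply Cdiff_mult; [apply H1 | apply H2];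
    [apply (Rlt_le_trans _ _ _ Hu (Rmin_l _ _)) | apply (Rlt_le_trans _ _ _ Hu (Rmin_r _ _))].
Qed.

Lemma holo_near_dilate (f : C -> C) (gamma z : C) :
  holo_near f (gamma * z)%C -> holo_near (dilate gamma f) z.
Proof.
  intros (e & He & H).
  assert (P := Cmod_ge_0 gamma).
  exists (e / (Cmod gamma + 1)); split; [apply Rdiv_lt_0_compat; lra|].
  intros u Hu; unfold disc in Hu; apply Rlt_div_r in Hu; [|lra].
  apply (Cdiff_comp (fun u => gamma * u)%C f).
  - apply Cdiff_mult; [apply Cdiff_const | apply Cdiff_id].
  - apply H; unfold disc.
    replace (gamma * u - gamma * z)%C with (gamma * (u - z))%C by ring.
    rewrite Cmod_mult; pose proof (Cmod_ge_0 (u - z)); nra.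
Qed.

Lemma meromorphic_not_pole (f : C -> C) (z : C) :
  meromorphic f -> ~ is_pole f z -> holo_near f z.
Proof.
  intros Hf Hz; destruct (Hf z) as ([|k] & Hk).
  - now apply holomorphic_at_near.
  - destruct Hz; exists (S k); split; [lia | exact Hk].
Qed.

Lemma Cpow_mult (x y : C) (n : nat) : (Cpow (x * y) n = Cpow x n * Cpow y n)%C.
Proof. induction n as [|n IH]; simpl; [ring | rewrite IH; ring]. Qed.

Lemma pole_order_dilate (f : C -> C) (gamma z : C) (k : nat) : gamma <> RtoC 0 ->
  pole_order f (gamma * z)%C k -> pole_order (dilate gamma f) z k.
Proof.
  intros Hgamma; destruct k as [|k]; unfold pole_order.
  - rewrite !holomorphic_at_near; apply holo_near_dilate.
  - intros (g & Hg & Hgz & Heq).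
    assert (Hp : Cpow gamma (S k) <> RtoC 0) by now apply Cpow_nz.
    (* [(gamma * u - gamma * z)] to the power [S k] splits off the same power of [gamma], which
       moves into the numerator. *)
    exists (fun u => g (gamma * u) * / Cpow gamma (S k))%C; split; [|split].
    + apply holomorphic_at_near, (holo_near_mult (dilate gamma g)).
      * apply holo_near_dilate, holomorphic_at_near, Hg.
      * exists 1; split; [lra|]; intros u _; apply Cdiff_const.
    + apply Cmult_neq_0; [exact Hgz |
        apply Cmod_gt_0; rewrite Cmod_inv by exact Hp; now apply Rinv_0_lt_compat, Cmod_gt_0].
    + unfold locally', within in *; apply locally_Cmod in Heq as (d & Hd & Heq).
      apply locally_Cmod; assert (P := proj1 (Cmod_gt_0 gamma) Hgamma).
      exists (d / Cmod gamma); split; [now apply Rdiv_lt_0_compat|].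
      intros u Hu Huz; apply Rlt_div_r in Hu; [|exact P].
      assert (Nu := Cminus_neq_0 u z Huz).
      assert (Np : Cpow (u - z) (S k) <> RtoC 0) by now apply Cpow_nz.
      unfold dilate; rewrite Heq.
      * replace (gamma * u - gamma * z)%C with (gamma * (u - z))%C by ring.
        rewrite Cpow_mult; field; auto.
      * replace (gamma * u - gamma * z)%C with (gamma * (u - z))%C by ring.
        rewrite Cmod_mult; lra.
      * intros E; apply (Cmult_neq_0 _ _ Hgamma Nu).
        replace (gamma * (u - z))%C with (gamma * u - gamma * z)%C by ring.
        rewrite E; ring.
Qed.

Lemma dilate_not_pole (f : C -> C) (gamma z : C) : meromorphic f -> gamma <> RtoC 0 ->
  ~ is_pole (dilate gamma f) z -> holo_near (dilate gamma f) z.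
Proof.
  intros Hf Hgamma Hz; apply meromorphic_not_pole; [|exact Hz].
  intros w; destruct (Hf (gamma * w)%C) as (k & Hk); exists k.
  now apply pole_order_dilate.
Qed.

Lemma Cdiff_Cpow (n : nat) (z : C) : Cdiff (fun u => Cpow u n) z.
Proof.
  induction n as [|n IH]; simpl; [apply Cdiff_const|].
  apply Cdiff_mult; [apply Cdiff_id | exact IH].
Qed.

Lemma Cdiff_Cpowz (m : Z) (z : C) : z <> RtoC 0 -> Cdiff (fun u => Cpowz u m) z.
Proof.
  intros Hz; destruct m as [|p|p]; simpl.
  - apply Cdiff_const.
  - apply Cdiff_Cpow.
  - apply Cdiff_inv; [apply Cdiff_Cpow | now apply Cpow_nz].
Qed.

Lemma holo_near_Cpowz (m : Z) (z : C) : z <> RtoC 0 -> holo_near (fun u => Cpowz u m) z.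
Proof.
  intros Hz; exists (Cmod z); split; [now apply Cmod_gt_0|].
  intros u Hu; apply Cdiff_Cpowz; intros ->; unfold disc in Hu.
  replace (0 - z)%C with (- z)%C in Hu by ring; rewrite Cmod_opp in Hu; lra.
Qed.

Lemma is_RInt_gen_Cmult (k : C) (f : R -> C) (Fa Fb : (R -> Prop) -> Prop)
    {FFa : Filter Fa} {FFb : Filter Fb} (l : C) :
  is_RInt_gen (V := C_R_NormedModule) f Fa Fb l ->
  is_RInt_gen (V := C_R_NormedModule) (fun t => k * f t)%C Fa Fb (k * l)%C.
Proof.
  rewrite !is_RInt_gen_Cmod by assumption; intros H eps Heps.
  pose proof (Cmod_ge_0 k).
  eapply filter_imp; [|apply (H (eps / (Cmod k + 1))); apply Rdiv_lt_0_compat; lra].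
  intros q (y & Hy & Hl); exists (k * y)%C; split; [now apply is_RInt_Cmult|].
  replace (k * y - k * l)%C with (k * (y - l))%C by ring.
  rewrite Cmod_mult; apply Rlt_div_r in Hl; [|lra].
  pose proof (Cmod_ge_0 (y - l)); nra.
Qed.

Lemma is_RInt_gen_sum_n (f : nat -> R -> C) (Fa Fb : (R -> Prop) -> Prop)
    {FFa : Filter Fa} {FFb : Filter Fb} (l : nat -> C) (N : nat) :
  (forall k, (k <= N)%nat -> is_RInt_gen (V := C_R_NormedModule) (f k) Fa Fb (l k)) ->
  is_RInt_gen (V := C_R_NormedModule)
    (fun t => sum_n (G := C_AbelianMonoid) (fun k => f k t) N) Fa Fb
    (sum_n (G := C_AbelianMonoid) l N).
Proof.
  assert (E : forall (P Q : R -> C) x y, (forall t, P t = Q t) -> x = y ->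
     is_RInt_gen (V := C_R_NormedModule) P Fa Fb x -> is_RInt_gen (V := C_R_NormedModule) Q Fa Fb y).
  { intros P Q x y HPQ <- ; rewrite !is_RInt_gen_Cmod by assumption.
    intros H eps Heps; generalize (H eps Heps); apply filter_imp.
    intros q (w & Hw & Hl); exists w; split; [|exact Hl].
    apply (is_RInt_ext (V := C_R_NormedModule) P); auto. }
  induction N as [|N IH]; intros H.
  - eapply E; [| |exact (H O (le_n _))]; [intros t|]; now rewrite sum_O.
  - eapply E; [| |exact (is_RInt_gen_plus (V := C_R_NormedModule) _ _ _ _
        (IH (fun k Hk => H k (Nat.le_le_succ_r _ _ Hk))) (H (S N) (le_n _)))];
      [intros t|]; now rewrite sum_Sn.
Qed.

Lemma contour_int_correct (g : C -> C) (G : R -> C) (ta tb : Rbar) :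
  ex_contour_int g G ta tb ->
  is_RInt_gen (V := C_R_NormedModule) (fun t => g (G t) * velocity G t)%C
    (end_filter ta) (end_filter tb) (contour_int g G ta tb).
Proof.
  intros H; apply (RInt_gen_correct (V := C_R_CompleteNormedModule)
    (fun t => g (G t) * velocity G t)%C); exact H.
Qed.

(** A bound that is uniform over truncations survives the limit, even if convergence is only
    conditional: a truncation closer to [l] than [Cmod l - B] would exceed [B]. *)
Lemma is_RInt_gen_Cmod_le (f : R -> C) (ta tb : Rbar) (l : C) (B : R) : Rbar_lt ta tb ->
  (forall u v y, in_dom ta tb u -> in_dom ta tb v -> u <= v -> is_RIntC f u v y -> Cmod y <= B) ->
  is_RInt_gen (V := C_R_NormedModule) f (end_filter ta) (end_filter tb) l -> Cmod l <= B.
Proof.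
  intros Hlt HB; rewrite is_RInt_gen_Cmod by apply end_filter_proper; intros Hl.
  apply Rnot_lt_le; intros Hgt.
  destruct (ends_separated ta tb Hlt) as (m & Sa & Sb).
  destruct (Hl (Cmod l - B)) as [Qa Qb HQa HQb HQ]; [lra|].
  destruct (filter_ex _ (filter_and _ _ HQa Sa)) as (u & Hu1 & Hu2 & Hu3).
  destruct (filter_ex _ (filter_and _ _ HQb Sb)) as (v & Hv1 & Hv2 & Hv3).
  destruct (HQ u v Hu1 Hv1) as (y & Hy & Hyl); simpl in Hy.
  specialize (HB u v y Hu2 Hv2 ltac:(lra) Hy).
  pose proof (Cmod_le_sub l y); lra.
Qed.

(** * The Laurent series *)

Lemma Cmod_Cpowz (z : C) (m : Z) : z <> RtoC 0 -> Cmod (Cpowz z m) = powerRZ (Cmod z) m.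
Proof.
  intros Hz; destruct m as [|p|p]; simpl.
  - apply Cmod_1.
  - apply Cmod_pow.
  - rewrite Cmod_inv by now apply Cpow_nz.
    now rewrite Cmod_pow.
Qed.

Lemma Cpowz_mult (x y : C) (m : Z) : x <> RtoC 0 -> y <> RtoC 0 ->
  Cpowz (x * y) m = (Cpowz x m * Cpowz y m)%C.
Proof.
  intros Hx Hy; destruct m as [|p|p]; simpl.
  - ring.
  - apply Cpow_mult.
  - rewrite Cpow_mult; field; split; now apply Cpow_nz.
Qed.

Lemma powerRZ_div (x y : R) (m : Z) : powerRZ (x / y) m = powerRZ x m / powerRZ y m.
Proof. unfold Rdiv; now rewrite powerRZ_mult, powerRZ_inv'. Qed.

Lemma powerRZ_le_ge_1 (x : R) (m m' : Z) : 1 <= x -> (m <= m')%Z ->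
  powerRZ x m <= powerRZ x m'.
Proof.
  intros Hx Hm.
  replace m' with (m + Z.of_nat (Z.to_nat (m' - m)))%Z by lia.
  rewrite powerRZ_add, <- pow_powerRZ by lra.
  pose proof (powerRZ_lt x m ltac:(lra)); pose proof (pow_R1_Rle x (Z.to_nat (m' - m)) Hx); nra.
Qed.

Lemma powerRZ_le_le_1 (x : R) (m m' : Z) : 0 < x <= 1 -> (m <= m')%Z ->
  powerRZ x m' <= powerRZ x m.
Proof.
  intros Hx Hm.
  rewrite <- (Rinv_inv x), !(powerRZ_inv' (/ x)).
  assert (1 <= / x) by (rewrite <- Rinv_1; apply Rinv_le_contravar; lra).
  apply Rinv_le_contravar; [apply powerRZ_lt; lra | now apply powerRZ_le_ge_1].
Qed.

Section Laurent.

Variables (f : C -> C) (n0 : nat) (a : Z -> C).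
Hypothesis Ha : laurent_at_0 f n0 a.

Definition term (z : C) (k : nat) : C := (a (idx n0 k) * Cpowz z (idx n0 k))%C.
Definition abs_term (x : R) (k : nat) : R := Cmod (a (idx n0 k)) * powerRZ x (idx n0 k).
Definition partial (z : C) (N : nat) : C := sum_n (G := C_AbelianMonoid) (term z) N.

Lemma Cmod_term (z : C) (k : nat) : z <> RtoC 0 -> Cmod (term z k) = abs_term (Cmod z) k.
Proof. intros Hz; unfold term, abs_term; now rewrite Cmod_mult, Cmod_Cpowz. Qed.

Lemma abs_term_pos (x : R) (k : nat) : 0 < x -> 0 <= abs_term x k.
Proof.
  intros Hx; apply Rmult_le_pos; [apply Cmod_ge_0 | now left; apply powerRZ_lt].
Qed.

Lemma partial_S (z : C) (N : nat) : partial z (S N) = (partial z N + term z (S N))%C.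
Proof. unfold partial; now rewrite sum_Sn. Qed.

Lemma laurent_partial (z : C) (eps : R) : z <> RtoC 0 -> Rbar_lt (Cmod z) (pole_dist0 f) ->
  0 < eps -> exists N, forall n, (N <= n)%nat -> Cmod (partial z n - f z) < eps.
Proof.
  intros Hz Hlt Heps; assert (H := Ha z Hz Hlt).
  unfold is_series in H; assert (H' := H (fun u => Cmod (u - f z) < eps)).
  apply H'; apply (locally_Cmod (f z)); exists eps; auto.
Qed.

Lemma bounded_of_eventually (u : nat -> R) (K : nat) (B : R) :
  (forall k, (K <= k)%nat -> u k <= B) -> exists M, forall k, u k <= M.
Proof.
  revert B; induction K as [|K IH]; intros B H.
  - exists B; intros k; apply H; lia.
  - apply (IH (Rmax B (u K))); intros k Hk.
    destruct (Nat.eq_dec k K) as [->|Hne]; [apply Rmax_r|].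
    eapply Rle_trans; [apply H; lia | apply Rmax_l].
Qed.

(** Abel's lemma: convergence at some [s] beyond [r] bounds the terms there, and the geometric
    series of ratio [r / s] dominates the terms at [r]. *)
Lemma ex_kappa (r : R) : 0 < r -> Rbar_lt r (pole_dist0 f) -> ex_series (abs_term r).
Proof.
  intros Hr Hlt.
  assert (Hs : exists s, r < s /\ Rbar_lt (Finite s) (pole_dist0 f)).
  { destruct (pole_dist0 f) as [R0| |]; simpl in *; [|exists (r + 1); split; [lra | exact I]|contradiction].
    exists ((r + R0) / 2); split; lra. }
  destruct Hs as (s & Hrs & Hs).
  assert (Cs : Cmod (RtoC s) = s) by (rewrite Cmod_R; apply Rabs_pos_eq; lra).
  assert (Ns : RtoC s <> RtoC 0) by (apply Cmod_gt_0; lra).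
  destruct (laurent_partial (RtoC s) 1 Ns) as (K & HK); [now rewrite Cs | lra|].
  (* From index [S K] on, a term is the difference of two partial sums within 1 of [f s], hence at
     most 2 in modulus. *)
  destruct (bounded_of_eventually (abs_term s) (S K) 2) as (M & HM).
  { intros k Hk; destruct k as [|k]; [lia|].
    rewrite <- Cs, <- Cmod_term by exact Ns.
    replace (term s (S k)) with ((partial s (S k) - f s) - (partial s k - f s))%C
      by (rewrite partial_S; ring).
    eapply Rle_trans; [apply Cmod_sub_le|].
    pose proof (HK (S k) ltac:(lia)); pose proof (HK k ltac:(lia)); lra. }
  assert (Hq : 0 < r / s < 1).
  { split; [apply Rdiv_lt_0_compat; lra | apply Rlt_div_l; lra]. }
  apply (ex_series_le (K := R_AbsRing) (V := R_CompleteNormedModule) (abs_term r)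
    (fun k => (M * powerRZ (r / s) (- Z.of_nat n0)) * (r / s) ^ k)).
  - intros k; change (norm (abs_term r k)) with (Rabs (abs_term r k)).
    rewrite Rabs_pos_eq by now apply abs_term_pos.
    replace ((M * powerRZ (r / s) (- Z.of_nat n0)) * (r / s) ^ k)
      with (M * powerRZ (r / s) (idx n0 k)).
    + replace (abs_term r k) with (abs_term s k * powerRZ (r / s) (idx n0 k)).
      * apply Rmult_le_compat_r; [left; apply powerRZ_lt; lra | apply HM].
      * unfold abs_term; rewrite powerRZ_div; field.
        pose proof (powerRZ_lt s (idx n0 k)); lra.
    + unfold idx; replace (Z.of_nat k - Z.of_nat n0)%Z with (- Z.of_nat n0 + Z.of_nat k)%Z by lia.
      rewrite powerRZ_add, <- pow_powerRZ by lra; ring.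
  - apply (ex_series_scal (K := R_AbsRing) (V := R_NormedModule)).
    apply ex_series_geom; rewrite Rabs_pos_eq; lra.
Qed.

Lemma sum_abs_le_kappa (r : R) (N : nat) : 0 < r -> Rbar_lt r (pole_dist0 f) ->
  sum_n (abs_term r) N <= kappa n0 a r.
Proof.
  intros Hr Hlt; apply (is_lim_seq_incr_compare (sum_n (abs_term r))).
  - apply (Series_correct (abs_term r)), ex_kappa; assumption.
  - intros n; rewrite sum_Sn; pose proof (abs_term_pos r (S n) Hr).
    unfold plus; simpl; lra.
Qed.

Lemma kappa_pos (r : R) : 0 < r -> Rbar_lt r (pole_dist0 f) -> 0 <= kappa n0 a r.
Proof.
  intros Hr Hlt; eapply Rle_trans; [|apply (sum_abs_le_kappa r 0 Hr Hlt)].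
  rewrite sum_O; now apply abs_term_pos.
Qed.

Lemma abs_term_ratio (x r : R) (k : nat) : 0 < x -> 0 < r ->
  abs_term x k = powerRZ (x / r) (idx n0 k) * abs_term r k.
Proof.
  intros Hx Hr; unfold abs_term; rewrite powerRZ_div; field.
  pose proof (powerRZ_lt r (idx n0 k) Hr); lra.
Qed.

(** Here [Cmod z / r <= 1], so for [m >= n + 1] its power [m] is at most its power [n + 1], and this
    factor comes out of the tail. *)
Lemma laurent_remainder (r : R) (z : C) (n : Z) : 0 < r -> Rbar_lt r (pole_dist0 f) ->
  (- Z.of_nat n0 <= n)%Z -> z <> RtoC 0 -> Cmod z <= r ->
  Cmod (f z - partial z (Z.to_nat (n + Z.of_nat n0)))
    <= powerRZ (Cmod z / r) (n + 1) * kappa n0 a r.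
Proof.
  intros Hr Hlt Hn Hz Hzr; set (N := Z.to_nat (n + Z.of_nat n0)).
  assert (Hx := proj1 (Cmod_gt_0 z) Hz).
  assert (Hq : 0 < Cmod z / r <= 1).
  { split; [apply Rdiv_lt_0_compat; lra | apply Rle_div_l; lra]. }
  assert (Hp := powerRZ_lt (Cmod z / r) (n + 1) ltac:(lra)).
  set (q := powerRZ (Cmod z / r) (n + 1)) in *.
  (* The right-hand side keeps all terms of [kappa] up to [j + N], not only the tail; the start of
     the induction then needs only their positivity. *)
  assert (Hj : forall j, Cmod (partial z (j + N) - partial z N) <= q * sum_n (abs_term r) (j + N)).
  { induction j as [|j IH].
    - change (0 + N)%nat with N; replace (partial z N - partial z N)%C with (RtoC 0) by ring.
      rewrite Cmod_0; apply Rmult_le_pos; [lra|].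
      clear - Hr; induction N as [|N IH]; [rewrite sum_O; now apply abs_term_pos|].
      rewrite sum_Sn; pose proof (abs_term_pos r (S N) Hr); unfold plus; simpl; lra.
    - change (S j + N)%nat with (S (j + N)); rewrite partial_S, sum_Sn.
      replace (partial z (j + N) + term z (S (j + N)) - partial z N)%C
        with ((partial z (j + N) - partial z N) + term z (S (j + N)))%C by ring.
      eapply Rle_trans; [apply Cmod_triangle|].
      rewrite Cmod_term, (abs_term_ratio _ r) by assumption.
      assert (powerRZ (Cmod z / r) (idx n0 (S (j + N))) <= q).
      { apply powerRZ_le_le_1; [exact Hq|]; unfold idx, N; lia. }
      pose proof (abs_term_pos r (S (j + N)) Hr).
      change (plus (sum_n (abs_term r) (j + N)) (abs_term r (S (j + N))))
        with (sum_n (abs_term r) (j + N) + abs_term r (S (j + N))); nra. }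
  apply le_epsilon; intros eps Heps.
  destruct (laurent_partial z eps Hz) as (K & HK); [|exact Heps|].
  { apply Rbar_le_lt_trans with (Finite r); [exact Hzr | exact Hlt]. }
  specialize (HK (K + N)%nat ltac:(lia)); rewrite Cmod_sub_sym in HK.
  pose proof (Cmod_sub_triangle (f z) (partial z (K + N)) (partial z N)).
  pose proof (sum_abs_le_kappa r (K + N) Hr Hlt); specialize (Hj K); nra.
Qed.

(** The mirror image for [Cmod z / r >= 1]: now the powers [m <= n] are dominated by the power
    [n + 1]. The sum is finite, so [z] may lie outside the annulus of convergence. *)
Lemma laurent_partial_bound (r : R) (z : C) (n : Z) : 0 < r -> Rbar_lt r (pole_dist0 f) ->
  (- Z.of_nat n0 <= n)%Z -> z <> RtoC 0 -> r <= Cmod z ->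
  Cmod (partial z (Z.to_nat (n + Z.of_nat n0)))
    <= powerRZ (Cmod z / r) (n + 1) * kappa n0 a r.
Proof.
  intros Hr Hlt Hn Hz Hzr; set (N := Z.to_nat (n + Z.of_nat n0)).
  assert (Hq : 1 <= Cmod z / r) by (apply Rle_div_r; lra).
  assert (Hp := powerRZ_lt (Cmod z / r) (n + 1) ltac:(lra)).
  assert (Hx := proj1 (Cmod_gt_0 z) Hz).
  set (q := powerRZ (Cmod z / r) (n + 1)) in *.
  assert (Hk : forall k, (k <= N)%nat -> Cmod (term z k) <= q * abs_term r k).
  { intros k Hk; rewrite Cmod_term, (abs_term_ratio _ r) by assumption.
    apply Rmult_le_compat_r; [now apply abs_term_pos|].
    apply powerRZ_le_ge_1; [exact Hq|]; unfold idx, N in *; lia. }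
  apply Rle_trans with (q * sum_n (abs_term r) N);
    [|apply Rmult_le_compat_l; [lra | now apply sum_abs_le_kappa]].
  clearbody N; induction N as [|N IH].
  - unfold partial; rewrite !sum_O; now apply Hk.
  - rewrite partial_S, sum_Sn; eapply Rle_trans; [apply Cmod_triangle|].
    assert (A := IH (fun k Hle => Hk k (Nat.le_le_succ_r _ _ Hle))).
    specialize (Hk (S N) (le_n _)); unfold plus; simpl in *; lra.
Qed.

End Laurent.

(** * Integrals along arcs of bounded angle *)

(** Cauchy-Schwarz puts the quotient in the range where [acos] is a true inverse of [cos]. *)
Lemma cos_line_angle (u v : C) : u <> RtoC 0 -> v <> RtoC 0 ->
  cos (line_angle u v) = Rabs (Re (u * Cconj v)) / (Cmod u * Cmod v).
Proof.
  intros Hu Hv; unfold line_angle; apply cos_acos.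
  apply Cmod_gt_0 in Hu; apply Cmod_gt_0 in Hv.
  assert (P : 0 < Cmod u * Cmod v) by now apply Rmult_lt_0_compat.
  split.
  - apply Rle_trans with 0; [lra|].
    apply Rdiv_le_0_compat; [apply Rabs_pos | exact P].
  - apply Rle_div_l; [exact P|]; rewrite Rmult_1_l.
    rewrite <- (Cmod_conj v), <- Cmod_mult; apply re_le_Cmod.
Qed.

Lemma continuous_Cmod (c : R -> C) (t : R) :
  continuous (U := C_UniformSpace) c t -> continuous (fun s => Cmod (c s)) t.
Proof.
  intros H; unfold continuous in H; rewrite filterlim_Cmod in H by apply locally_filter.
  apply filterlim_locally; intros eps.
  generalize (H eps (cond_pos eps)); apply filter_imp; intros s Hs.
  change (Rabs (Cmod (c s) - Cmod (c t)) < eps).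
  apply Rle_lt_trans with (Cmod (c s - c t)); [|exact Hs].
  pose proof (Cmod_le_sub (c s) (c t)) as A1; rewrite Cmod_sub_sym in A1.
  pose proof (Cmod_le_sub (c t) (c s)); apply Rabs_le_between; lra.
Qed.

Lemma is_derive_hypot (x y : R -> R) (t x' y' : R) : 0 < x t ^ 2 + y t ^ 2 ->
  is_derive x t x' -> is_derive y t y' ->
  is_derive (fun s => sqrt (x s ^ 2 + y s ^ 2)) t
    ((x t * x' + y t * y') / sqrt (x t ^ 2 + y t ^ 2)).
Proof.
  intros P D1 D2.
  assert (E1 := is_derive_unique _ _ _ D1); assert (E2 := is_derive_unique _ _ _ D2).
  auto_derive.
  - repeat split; [now exists x' | now exists y' | simpl in P; lra].
  - change (Derive (fun s => x s) t = x') in E1; change (Derive (fun s => y s) t = y') in E2.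
    rewrite E1, E2.
    assert (Q := sqrt_lt_R0 _ P); simpl in Q |- *; field; lra.
Qed.

Lemma is_derive_Cmod (c : R -> C) (t : R) (l : C) : c t <> RtoC 0 ->
  is_derive (K := R_AbsRing) (V := C_R_NormedModule) c t l ->
  is_derive (fun s => Cmod (c s)) t (Re (c t * Cconj l) / Cmod (c t)).
Proof.
  intros Hc Hd; apply is_derive_components in Hd as [D1 D2].
  apply Cmod_gt_0 in Hc; unfold Cmod in *.
  replace (Re (c t * Cconj l)) with (fst (c t) * fst l + snd (c t) * snd l)
    by (destruct l, (c t); simpl; ring).
  apply (is_derive_hypot (fun s => fst (c s)) (fun s => snd (c s))); auto.
  apply Rnot_le_lt; intros Hle; rewrite sqrt_neg_0 in Hc by exact Hle; lra.
Qed.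

Lemma is_derive_exp_scal (k : R) (x : R -> R) (t x' : R) : is_derive x t x' ->
  is_derive (fun s => exp (k * x s)) t (k * x' * exp (k * x t)).
Proof.
  intros D; assert (E := is_derive_unique _ _ _ D); auto_derive; [now exists x'|].
  change (Derive (fun s => x s) t = x') in E; rewrite E; ring.
Qed.

Lemma continuous_sign (phi : R -> R) : (forall t, continuous phi t) ->
  (forall t, phi t <> 0) -> (forall t, 0 < phi t) \/ (forall t, phi t < 0).
Proof.
  intros Hc Hn.
  assert (C : continuity phi) by (intros t; apply continuity_pt_filterlim, Hc).
  assert (Same : forall x y, x <= y -> 0 < phi x * phi y).
  { intros x y Hxy; apply Rnot_le_lt; intros Hle.
    destruct (IVT_cor phi x y C Hxy Hle) as (z & _ & Hz); now apply (Hn z). }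
  assert (Same' : forall y, 0 < phi 0 * phi y).
  { intros y; destruct (Rle_dec 0 y); [now apply Same|].
    rewrite Rmult_comm; apply Same; lra. }
  destruct (Rtotal_order (phi 0) 0) as [Hneg|[H0|Hpos]]; [right|now destruct (Hn 0)|left];
    intros t; specialize (Same' t); nra.
Qed.

(* The angle condition makes the modulus monotone along the arc, with
   |dz| <= d|z| / b. *)
Lemma arc_estimate (c : R -> C) (p q : Rbar) (D h : R -> C) (u v b delta M : R) (y : C) :
  0 < b -> 0 < delta -> 0 <= M ->
  C1_arc c p q D -> u <= v -> in_dom p q u -> in_dom p q v ->
  (forall t, u <= t <= v -> c t <> RtoC 0) ->
  (forall t, u <= t <= v -> D t <> RtoC 0) ->
  (forall t, u <= t <= v -> b <= Rabs (cos (line_angle (c t) (D t)))) ->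
  (forall t, u <= t <= v -> Cmod (h t) <= M * exp (- delta * Cmod (c t))) ->
  is_RIntC (fun t => h t * velocity c t)%C u v y ->
  Cmod y <= M / (b * delta).
Proof.
  intros Hb Hdelta HM (Cc & CD & Dc) Huv Hu Hv Nc ND Hangle Hh HI.
  assert (HD : forall s, u <= s <= v -> in_dom p q s).
  { intros s Hs; split.
    - apply Rbar_le_trans with (Finite u); [apply Hu | apply Hs].
    - apply Rbar_le_trans with (Finite v); [apply Hs | apply Hv]. }
  assert (Kc := continuous_clamp c _ u v Huv HD Cc).
  assert (KD := continuous_clamp D _ u v Huv HD CD).
  (* The real scalar product of [c] and its derivative, that is, the modulus times its derivative.
     The angle condition bounds it away from zero, so its sign is constant. *)
  set (chi := fun t => Re (c (clamp u v t) * Cconj (D (clamp u v t)))).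
  assert (Hchi : forall t, u <= t <= v -> b * Cmod (D t) * Cmod (c t) <= Rabs (chi t)).
  { intros t Ht; unfold chi; rewrite clamp_id by exact Ht.
    assert (A := Hangle t Ht); rewrite cos_line_angle in A by auto.
    assert (Pc := proj1 (Cmod_gt_0 _) (Nc t Ht)); assert (PD := proj1 (Cmod_gt_0 _) (ND t Ht)).
    rewrite Rabs_pos_eq in A by (apply Rdiv_le_0_compat; [apply Rabs_pos | nra]).
    apply Rle_div_r in A; [|nra]; lra. }
  assert (Kchi : forall t, continuous chi t).
  { intros t; unfold chi.
    assert (E : forall s, Re (c (clamp u v s) * Cconj (D (clamp u v s))) =
      plus (mult (fst (c (clamp u v s))) (fst (D (clamp u v s))))
           (mult (snd (c (clamp u v s))) (snd (D (clamp u v s)))))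
      by (intros s; destruct (c (clamp u v s)), (D (clamp u v s)); unfold plus, mult; simpl; ring).
    apply (continuous_ext (fun s => plus (mult (fst (c (clamp u v s))) (fst (D (clamp u v s))))
           (mult (snd (c (clamp u v s))) (snd (D (clamp u v s)))))); [now intros; symmetry|].
    apply (continuous_plus (V := R_NormedModule)); apply (continuous_mult (K := R_AbsRing)).
    - apply (continuous_comp (fun s => c (clamp u v s)) fst); [apply Kc | apply continuous_fst].
    - apply (continuous_comp (fun s => D (clamp u v s)) fst); [apply KD | apply continuous_fst].
    - apply (continuous_comp (fun s => c (clamp u v s)) snd); [apply Kc | apply continuous_snd].
    - apply (continuous_comp (fun s => D (clamp u v s)) snd); [apply KD | apply continuous_snd]. }
  assert (Nchi : forall t, chi t <> 0).
  { intros t; assert (Ht := clamp_in u v t Huv); assert (A := Hchi _ Ht).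
    assert (Pc := proj1 (Cmod_gt_0 _) (Nc _ Ht)); assert (PD := proj1 (Cmod_gt_0 _) (ND _ Ht)).
    assert (E : chi (clamp u v t) = chi t) by (unfold chi; now rewrite clamp_id).
    rewrite E in A; intros Z; rewrite Z, Rabs_R0 in A.
    assert (0 < b * Cmod (D (clamp u v t))) by nra; nra. }
  set (rho := fun t => Cmod (c (clamp u v t))).
  assert (Krho : forall t, continuous rho t)
    by (intros t; apply (continuous_Cmod (fun s => c (clamp u v s))), Kc).
  assert (Prho : forall t, 0 < rho t).
  { intros t; apply (proj1 (Cmod_gt_0 _)), Nc, clamp_in, Huv. }
  (* The comparison function: up to the factor [M / (b * delta)], the absolute value of its
     derivative [dpsi] dominates the integrand. *)
  set (psi := fun t => exp (- delta * rho t)).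
  set (dpsi := fun t => mult (psi t) (mult (- delta) (mult (chi t) (/ rho t)))).
  assert (Kpsi : forall t, continuous psi t).
  { intros t; apply continuous_exp_comp.
    apply (continuous_mult (K := R_AbsRing)); [apply continuous_const | apply Krho]. }
  assert (Kdpsi : forall t, continuous dpsi t).
  { intros t; apply (continuous_mult (K := R_AbsRing)); [apply Kpsi|].
    apply (continuous_mult (K := R_AbsRing)); [apply continuous_const|].
    apply (continuous_mult (K := R_AbsRing)); [apply Kchi|].
    apply continuous_Rinv_comp; [apply Krho | specialize (Prho t); lra]. }
  assert (Dpsi : is_RInt dpsi u v (psi v - psi u)).
  { apply ftc_open_interval; auto.
    intros t Ht.
    apply (is_derive_ext_loc (fun s => exp (- delta * Cmod (c s)))).
    - exists (mkposreal (Rmin (t - u) (v - t)) ltac:(apply Rmin_pos; lra)).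
      intros s Hs; change (Rabs (s - t) < Rmin (t - u) (v - t)) in Hs.
      apply Rmin_Rgt in Hs as [Hs1 Hs2].
      apply Rgt_lt, Rabs_lt_between in Hs1; apply Rgt_lt, Rabs_lt_between in Hs2.
      unfold psi, rho; rewrite clamp_id; [reflexivity | lra].
    - assert (A : is_derive (fun s => Cmod (c s)) t (chi t / rho t)).
      { unfold chi, rho; rewrite clamp_id by lra; apply is_derive_Cmod.
        - apply Nc; lra.
        - apply Dc; [apply Rbar_le_lt_trans with (Finite u) | apply Rbar_lt_le_trans with (Finite v)];
            [apply Hu | apply Ht | apply Ht | apply Hv]. }
      replace (dpsi t) with (- delta * (chi t / rho t) * exp (- delta * Cmod (c t))).
      + apply is_derive_exp_scal, A.
      + unfold dpsi, psi, mult, Rdiv; simpl.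
        replace (rho t) with (Cmod (c t)) by (unfold rho; rewrite clamp_id by lra; reflexivity).
        ring. }
  (* [sg] is the constant sign of [- chi]; with it the absolute value of [dpsi] integrates to an
     increment of [psi]. *)
  assert (Sgn : exists sg, (sg = 1 \/ sg = -1) /\ forall t, sg * dpsi t = Rabs (dpsi t)).
  { destruct (continuous_sign chi Kchi Nchi) as [Hp|Hp]; [exists (-1) | exists 1]; (split; [auto|]);
      intros t; unfold dpsi, mult; simpl;
      assert (P1 := exp_pos (- delta * rho t)); fold (psi t) in P1;
      assert (P2 : 0 < / rho t) by apply Rinv_0_lt_compat, Prho; specialize (Hp t).
    - rewrite Rabs_left1; [ring|].
      assert (0 < chi t * / rho t) by nra; assert (0 < psi t * delta) by nra; nra.
    - rewrite Rabs_pos_eq; [ring|].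
      assert (0 < - (chi t * / rho t)) by nra; assert (0 < psi t * delta) by nra; nra. }
  destruct Sgn as (sg & Hsg & Habs).
  assert (HI' : is_RIntC (fun t => h t * D t)%C u v y).
  { apply (is_RInt_ext (V := C_R_NormedModule) (fun t => h t * velocity c t)%C); [|exact HI].
    rewrite Rmin_left, Rmax_right by lra; intros t Ht; f_equal; apply velocity_derive, Dc;
      [apply Rbar_le_lt_trans with (Finite u) | apply Rbar_lt_le_trans with (Finite v)];
      [apply Hu | apply Ht | apply Ht | apply Hv]. }
  assert (Pbd : 0 < b * delta) by nra.
  assert (Hdom := is_RInt_scal (V := R_NormedModule) dpsi u v (M / (b * delta) * sg) _ Dpsi).
  assert (Hle : norm (y : C_R_NormedModule) <= M / (b * delta) * sg * (psi v - psi u)).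
  { refine (norm_RInt_le (V := C_R_NormedModule) _ _ u v _ _ Huv _ HI' Hdom).
    intros t Ht; rewrite C_R_norm, Cmod_mult.
    change (Cmod (h t) * Cmod (D t) <= M / (b * delta) * sg * dpsi t).
    rewrite Rmult_assoc, Habs; unfold dpsi, mult; simpl.
    assert (P1 := exp_pos (- delta * rho t)); fold (psi t) in P1.
    specialize (Hh t Ht); specialize (Hchi t Ht).
    assert (Er : Cmod (c t) = rho t) by (unfold rho; now rewrite clamp_id).
    rewrite Er in Hh, Hchi; fold (psi t) in Hh; specialize (Prho t).
    rewrite !Rabs_mult, Rabs_Ropp, (Rabs_pos_eq (psi t)), (Rabs_pos_eq delta),
      (Rabs_pos_eq (/ rho t)) by (try lra; left; now apply Rinv_0_lt_compat).
    assert (PD := Cmod_ge_0 (D t)).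
    apply Rle_trans with (M * psi t * Cmod (D t)); [now apply Rmult_le_compat_r|].
    replace (M / (b * delta) * (psi t * (delta * (Rabs (chi t) * / rho t))))
      with (M * psi t * (Rabs (chi t) / (b * rho t))) by (field; lra).
    apply Rmult_le_compat_l; [nra|].
    apply Rle_div_r; nra. }
  rewrite C_R_norm in Hle; eapply Rle_trans; [exact Hle|].
  (* Both end values lie in [(0, 1]], so the increment of [psi] is at most 1 whichever way the arc
     runs. *)
  assert (Bpsi : forall t, 0 < psi t <= 1).
  { intros t; split; [apply exp_pos|]; rewrite <- exp_0; left; apply exp_increasing.
    specialize (Prho t); nra. }
  assert (Pq : 0 <= M / (b * delta)) by (apply Rdiv_le_0_compat; assumption).
  pose proof (Bpsi u); pose proof (Bpsi v).
  destruct Hsg as [-> | ->]; nra.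
Qed.

Lemma breakpoints_monotone (p : nat -> Rbar) (d : nat) :
  (forall i, (i < d)%nat -> Rbar_lt (p i) (p (S i))) ->
  forall i j, (i <= j)%nat -> (j <= d)%nat -> Rbar_le (p i) (p j).
Proof.
  intros H i j Hij; induction Hij as [|j Hij IH]; intros Hj; [apply Rbar_le_refl|].
  eapply Rbar_le_trans; [apply IH; lia | apply Rbar_lt_le, H; lia].
Qed.

Theorem curve_estimate (c : R -> C) (ta tb : Rbar) (d : nat) (p : nat -> Rbar) (D : nat -> R -> C)
    (h : R -> C) (u v b delta M : R) (y : C) :
  0 < b -> 0 < delta -> 0 <= M -> smooth_arcs c ta tb d p D ->
  (forall t, in_dom ta tb t -> c t <> RtoC 0) ->
  (forall i t, (i < d)%nat -> in_dom (p i) (p (S i)) t ->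
     b <= Rabs (cos (line_angle (c t) (D i t)))) ->
  (forall t, in_dom ta tb t -> Cmod (h t) <= M * exp (- delta * Cmod (c t))) ->
  u <= v -> in_dom ta tb u -> in_dom ta tb v ->
  is_RIntC (fun t => h t * velocity c t)%C u v y ->
  Cmod y <= INR d * (M / (b * delta)).
Proof.
  intros Hb Hdelta HM ((Hp0 & Hpd & Harcs) & HDn) Hc Hangle Hh Huv Hu Hv HI.
  assert (B0 : 0 <= M / (b * delta)) by (apply Rdiv_le_0_compat; nra).
  rewrite <- Hp0, <- Hpd in Hu, Hv.
  assert (Mono := breakpoints_monotone p d (fun i Hi => proj1 (Harcs i Hi))).
  (* The predicate quantifies over the value [y], so that an integral known on the whole interval
     can be split by Chasles and each part estimated. *)
  refine (arc_chain (fun n u v => forall y,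
    is_RIntC (fun t => h t * velocity c t)%C u v y -> Cmod y <= INR n * (M / (b * delta)))
    p d _ _ _ _ u v Huv Hu Hv y HI); clear u v y Huv Hu Hv HI.
  - intros u y Hy.
    assert (E := is_RIntC_unique _ _ _ _ _ Hy (is_RInt_point (V := C_R_NormedModule) _ u)).
    rewrite E; change (Cmod (RtoC 0) <= INR 0 * (M / (b * delta))); rewrite Cmod_0; simpl; lra.
  - intros n u v H y Hy; rewrite S_INR; specialize (H y Hy); lra.
  - intros n u m v Hm H1 H2 y Hy.
    assert (Ex : ex_RInt (V := C_R_CompleteNormedModule) (fun t => h t * velocity c t)%C u v)
      by (now exists y).
    destruct (ex_RInt_Chasles_1 (V := C_R_CompleteNormedModule) _ u m v Hm Ex) as (y1 & Hy1).
    destruct (ex_RInt_Chasles_2 (V := C_R_CompleteNormedModule) _ u m v Hm Ex) as (y2 & Hy2).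
    assert (E := is_RIntC_unique _ _ _ _ _ Hy (is_RInt_Chasles (V := C_R_NormedModule) _ u m v _ _ Hy1 Hy2)).
    rewrite E; change (Cmod (y1 + y2) <= INR (S n) * (M / (b * delta))).
    eapply Rle_trans; [apply Cmod_triangle|].
    specialize (H1 y1 Hy1); specialize (H2 y2 Hy2); rewrite S_INR; simpl in H2; lra.
  - intros i u v Hi Huv Hu Hv y Hy; rewrite Rmult_1_l.
    assert (HD : forall s, u <= s <= v -> in_dom (p i) (p (S i)) s).
    { intros s Hs; split.
      - apply Rbar_le_trans with (Finite u); [apply Hu | apply Hs].
      - apply Rbar_le_trans with (Finite v); [apply Hs | apply Hv]. }
    assert (HD' : forall s, u <= s <= v -> in_dom ta tb s).
    { intros s Hs; destruct (HD s Hs) as [A1 A2]; split.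
      - rewrite <- Hp0; eapply Rbar_le_trans; [|exact A1]; apply Mono; lia.
      - rewrite <- Hpd; eapply Rbar_le_trans; [exact A2|]; apply Mono; lia. }
    apply (arc_estimate c (p i) (p (S i)) (D i) h u v); auto.
    apply (Harcs i Hi).
Qed.

(** * The error bound *)

Lemma sum_n_Cmult (q : C) (F : nat -> C) (N : nat) :
  sum_n (G := C_AbelianMonoid) (fun k => q * F k)%C N
  = (q * sum_n (G := C_AbelianMonoid) F N)%C.
Proof.
  induction N as [|N IH]; [now rewrite !sum_O|].
  rewrite !sum_Sn, IH; change ((q * sum_n (G := C_AbelianMonoid) F N + q * F (S N))%C
    = (q * (sum_n (G := C_AbelianMonoid) F N + F (S N)))%C); ring.
Qed.

Lemma curve_dist0_le (G : R -> C) (ta tb : Rbar) (z : C) :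
  on_curve G ta tb z -> curve_dist0 G ta tb <= Cmod z.
Proof.
  intros Hz; unfold curve_dist0.
  destruct (Glb_Rbar_correct (fun x => exists z, on_curve G ta tb z /\ x = Cmod z)) as [Hlb _].
  specialize (Hlb (Cmod z) (ex_intro _ z (conj Hz eq_refl))).
  (* [real] sends infinite values to 0: plus infinity is excluded by [z], and for minus infinity the
     claim is [0 <= Cmod z]. *)
  destruct (Glb_Rbar _) as [x| |]; simpl in *; [exact Hlb | contradiction | apply Cmod_ge_0].
Qed.

Lemma integrand_bound (n0 k0 : nat) (n : Z) (Kz fz Pz gamma z : C)
    (r rho cwv ctv delta1 delta2 kap : R) :
  (- Z.of_nat n0 <= n < Z.of_nat k0 - 1)%Z ->
  0 < r -> 0 < rho -> 0 <= cwv -> 0 <= ctv -> 0 <= kap -> 0 < delta2 ->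
  0 < Cmod gamma < r -> rho <= Cmod z ->
  Cmod Kz <= cwv * exp (- delta1 * Cmod z) * / Cmod z ^ k0 ->
  Cmod fz <= ctv * exp (delta2 * Cmod z) * / Cmod (gamma * z) ^ n0 ->
  (Cmod (gamma * z) <= r ->
     Cmod (fz - Pz) <= powerRZ (Cmod (gamma * z) / r) (n + 1) * kap) ->
  (r <= Cmod (gamma * z) -> Cmod Pz <= powerRZ (Cmod (gamma * z) / r) (n + 1) * kap) ->
  Cmod (Kz * (fz - Pz)) <=
    cwv * powerRZ (Cmod gamma / r) (n + 1) *
      (ctv * powerRZ r (- Z.of_nat n0)
       + Rmax (powerRZ r (- Z.of_nat n0)) (powerRZ rho (n - Z.of_nat k0 + 1)) * kap)
    * exp (- (delta1 - delta2) * Cmod z).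
Proof.
  intros Hn Hr Hrho Hcw Hct Hkap Hd2 Hgam Hz HK Hf Hin Hout.
  rewrite Cmod_mult in *; set (G := Cmod gamma) in *; set (L := Cmod z) in *.
  assert (HL : 0 < L) by lra.
  set (q := powerRZ (G / r) (n + 1)).
  set (A := powerRZ L (n - Z.of_nat k0 + 1)).
  set (R0 := powerRZ r (- Z.of_nat n0)).
  set (Mx := Rmax R0 (powerRZ rho (n - Z.of_nat k0 + 1))).
  set (e := exp (- (delta1 - delta2) * L)).
  assert (Hq : 0 < q) by (apply powerRZ_lt, Rdiv_lt_0_compat; lra).
  assert (HA : 0 < A) by now apply powerRZ_lt.
  assert (HR0 : 0 < R0) by now apply powerRZ_lt.
  assert (He : 0 < e) by apply exp_pos.
  assert (HAM : A <= Mx).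
  { apply Rle_trans with (powerRZ rho (n - Z.of_nat k0 + 1)); [|apply Rmax_r].
    replace A with (powerRZ (L / rho) (n - Z.of_nat k0 + 1) * powerRZ rho (n - Z.of_nat k0 + 1)).
    - assert (P := powerRZ_lt rho (n - Z.of_nat k0 + 1) Hrho).
      assert (powerRZ (L / rho) (n - Z.of_nat k0 + 1) <= powerRZ (L / rho) 0).
      { apply powerRZ_le_ge_1; [apply Rle_div_r; lra | lia]. }
      simpl in *; nra.
    - unfold A; rewrite powerRZ_div; field.
      pose proof (powerRZ_lt rho (n - Z.of_nat k0 + 1) Hrho); lra. }
  (* This separates the dependence on [gamma] from the power of [L], to which the pole of the kernel
     contributes [- k0]. *)
  assert (HqA : powerRZ (G * L / r) (n + 1) * / L ^ k0 = q * A).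
  { replace (G * L / r) with (G / r * L) by (field; lra).
    unfold q, A; rewrite powerRZ_mult, pow_powerRZ, <- powerRZ_neg'.
    rewrite Rmult_assoc, <- powerRZ_add by lra; do 2 f_equal; lia. }
  assert (HLk : 0 < / L ^ k0) by (apply Rinv_0_lt_compat, pow_lt, HL).
  set (Q := powerRZ (G * L / r) (n + 1)) in *.
  assert (He1 : exp (- delta1 * L) <= e).
  { unfold e; destruct (Rle_lt_or_eq_dec (- delta1 * L) (- (delta1 - delta2) * L)) as [Hlt|Heq];
      [nra | left; now apply exp_increasing | rewrite Heq; lra]. }
  assert (P1 := exp_pos (- delta1 * L)).
  assert (HKE : Cmod Kz * Cmod (fz - Pz) <= cwv * (exp (- delta1 * L) * (/ L ^ k0 * Cmod (fz - Pz)))).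
  { replace (cwv * (exp (- delta1 * L) * (/ L ^ k0 * Cmod (fz - Pz))))
      with (cwv * exp (- delta1 * L) * / L ^ k0 * Cmod (fz - Pz)) by ring.
    apply Rmult_le_compat_r; [apply Cmod_ge_0 | exact HK]. }
  eapply Rle_trans; [exact HKE|].
  replace (cwv * q * (ctv * R0 + Mx * kap) * e)
    with (cwv * (e * (q * (ctv * R0 + Mx * kap)))) by ring.
  apply Rmult_le_compat_l; [exact Hcw|].
  assert (Main : e * (q * (A * kap)) <= e * (q * (Mx * kap))).
  { apply Rmult_le_compat_l; [lra|]; apply Rmult_le_compat_l; [lra|].
    now apply Rmult_le_compat_r. }
  destruct (Rle_dec (G * L) r) as [Hle|Hgt].
  - specialize (Hin Hle).
    apply Rle_trans with (e * (q * (A * kap))).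
    + apply Rmult_le_compat; [lra | | exact He1 |].
      * apply Rmult_le_pos; [lra | apply Cmod_ge_0].
      * replace (q * (A * kap)) with (/ L ^ k0 * (Q * kap))
          by (transitivity (q * A * kap); [rewrite <- HqA|]; ring).
        apply Rmult_le_compat_l; [lra | exact Hin].
    + eapply Rle_trans; [exact Main|].
      apply Rmult_le_compat_l; [lra|]; apply Rmult_le_compat_l; [lra|].
      assert (0 <= ctv * R0) by nra; lra.
  - specialize (Hout ltac:(lra)).
    (* From [G < r < G * L]. Hence [A <= 1], so the term from [f] needs no power of [rho]. *)
    assert (HL1 : 1 <= L) by nra.
    assert (HA1 : A <= 1).
    { change 1 with (powerRZ L 0); apply powerRZ_le_ge_1; [exact HL1 | lia]. }
    assert (Hx : 1 <= G * L / r) by (apply Rle_div_r; lra).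
    (* The pole factor of [f] is raised to the exponent [n + 1] of the other terms: the base
       [G * L / r] is at least 1 and [- n0 <= n + 1]. *)
    assert (HxQ : / (G * L) ^ n0 <= Q * R0).
    { replace (/ (G * L) ^ n0) with (powerRZ (G * L / r) (- Z.of_nat n0) * R0).
      - apply Rmult_le_compat_r; [lra|]; apply powerRZ_le_ge_1; [exact Hx | lia].
      - unfold R0; rewrite powerRZ_div, !powerRZ_neg', <- !pow_powerRZ.
        field; split; apply pow_nonzero; nra. }
    assert (P2 := exp_pos (delta2 * L)).
    assert (Ee : exp (- delta1 * L) * exp (delta2 * L) = e)
      by (unfold e; rewrite <- exp_plus; f_equal; ring).
    assert (HQ : 0 < Q) by (apply powerRZ_lt; lra).
    assert (Tri : Cmod (fz - Pz) <= ctv * exp (delta2 * L) * (Q * R0) + Q * kap).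
    { eapply Rle_trans; [apply Cmod_sub_le|]; apply Rplus_le_compat; [|exact Hout].
      eapply Rle_trans; [exact Hf|]; apply Rmult_le_compat_l; [nra | exact HxQ]. }
    apply Rle_trans with
      (exp (- delta1 * L) * (/ L ^ k0 * (ctv * exp (delta2 * L) * (Q * R0) + Q * kap))).
    { apply Rmult_le_compat_l; [lra|]; apply Rmult_le_compat_l; lra. }
    replace (exp (- delta1 * L) * (/ L ^ k0 * (ctv * exp (delta2 * L) * (Q * R0) + Q * kap)))
      with (e * (q * A * (ctv * R0)) + exp (- delta1 * L) * (q * A * kap))
      by (rewrite <- HqA, <- Ee; ring).
    (* The two terms are compared separately: the one from [f] uses up the growth [exp (delta2 * L)]
       and [A <= 1], the one from the partial sum uses [A <= Mx]. *)
    replace (e * (q * (ctv * R0 + Mx * kap)))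
      with (e * (q * 1 * (ctv * R0)) + e * (q * (Mx * kap))) by ring.
    apply Rplus_le_compat.
    + apply Rmult_le_compat_l; [lra|]; apply Rmult_le_compat_r; [nra|].
      apply Rmult_le_compat_l; lra.
    + eapply Rle_trans; [|exact Main].
      rewrite (Rmult_assoc q A kap); apply Rmult_le_compat_r; [|exact He1].
      assert (0 <= A * kap) by nra; nra.
Qed.

Lemma Cbar_nonneg (d n0 k0 : nat) (a : Z -> C) (b c : R) (n : Z) (r rho : R) :
  0 < b -> 0 < c -> 0 < r -> 0 <= kappa n0 a r -> 0 <= Cbar d n0 k0 a b c n r rho.
Proof.
  intros Hb Hc Hr Hk; unfold Cbar.
  assert (P0 := powerRZ_lt r (- Z.of_nat n0) Hr); assert (P1 := powerRZ_lt r (n + 1) Hr).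
  assert (PM := Rmax_l (powerRZ r (- Z.of_nat n0)) (powerRZ rho (n - Z.of_nat k0 + 1))).
  apply Rdiv_le_0_compat; [|nra].
  assert (Pd := pos_INR d).
  apply Rplus_le_le_0_compat; apply Rmult_le_pos; try lra; apply Rmult_le_pos; lra.
Qed.

Theorem theorem5
  (* the kernel; its slices are normalised as meromorphic functions of z *)
  (W : C -> Prop) (hWo : open (T := C_UniformSpace) W)
  (hWc : connected_set (T := C_UniformSpace) W)
  (K : C -> C -> C) (hK : meromorphic2_on W K)
  (hKpol : forall w : C, W w -> ~ (forall z : C, pole_divisor K w z))
  (hKw : forall w : C, W w -> meromorphic (K w))
  (k0 : nat) (hk0 : forall w : C, W w -> pole_order (K w) (RtoC 0) k0)
  (* the curves *)
  (ta tb : Rbar) (htab : Rbar_lt ta tb)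
  (Gam : C -> R -> C)
  (hGc : continuous_family (T := C_UniformSpace) W Gam ta tb)
  (hGs : forall w : C, W w -> piecewise_C1 (Gam w) ta tb)
  (* the set of dilation parameters *)
  (U : C -> Prop) (hUo : open (T := C_UniformSpace) U)
  (hUc : connected_set (T := C_UniformSpace) U)
  (hUne : exists gamma : C, U gamma)
  (hU0 : closure_of (T := C_UniformSpace) U (RtoC 0)) (hU0' : ~ U (RtoC 0))
  (* the function and its Laurent expansion at 0 *)
  (f : C -> C) (hf : meromorphic f)
  (n0 : nat) (hn0 : pole_order f (RtoC 0) n0)
  (a : Z -> C) (ha : laurent_at_0 f n0 a)
  (* the transform and the moments *)
  (hGK : forall w z : C, W w -> on_curve (Gam w) ta tb z -> ~ is_pole (K w) z)
  (hGf : forall w gamma z : C, W w -> U gamma -> on_curve (Gam w) ta tb z ->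
     ~ is_pole (dilate gamma f) z)
  (hA : forall w gamma : C, W w -> U gamma ->
     ex_contour_int (fun z => Cmult (K w z) (dilate gamma f z)) (Gam w) ta tb)
  (hh : forall (m : Z) (w : C), W w ->
     ex_contour_int (fun z => Cmult (K w z) (Cpowz z m)) (Gam w) ta tb)
  (hhol : forall (m : Z) (w : C), W w ->
     holomorphic_at (moment K Gam ta tb m) w)
  (* the deformed curves *)
  (r : R) (hr : 0 < r) (hrf : Rbar_lt (Finite r) (pole_dist0 f))
  (Gamb : C -> R -> C)
  (hdef : forall w gamma : C, W w -> U gamma -> Cmod gamma < r ->
     exists H : R -> R -> C,
       deformation (fun z => ~ is_pole (K w) z /\ ~ is_pole (dilate gamma f) z)
         ta tb (Gam w) (Gamb w) H /\
       forall e : Rbar, e = ta \/ e = tb ->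
         negligible_end (fun z => Cmult (K w z) (dilate gamma f z)) H e /\
         forall m : Z, (- Z.of_nat n0 <= m < Z.of_nat k0 - 1)%Z ->
           negligible_end (fun z => Cmult (K w z) (Cpowz z m)) H e)
  (d : nat) (p : C -> nat -> Rbar) (D : C -> nat -> R -> C)
  (harcs : forall w : C, W w -> smooth_arcs (Gamb w) ta tb d (p w) (D w))
  (* the estimates *)
  (b c delta1 delta2 : R) (hb : 0 < b) (hc : 0 < c)
  (hdelta1 : 0 < delta1) (hdelta2 : 0 < delta2) (hdelta : 0 < delta1 - delta2)
  (cw : C -> R) (hcw : forall w : C, W w -> 0 <= cw w)
  (ct : C -> R) (hct : forall gamma : C, U gamma -> c <= ct gamma)
  (hangle : forall (w : C) (i : nat) (t : R), W w -> (i < d)%nat ->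
     in_dom (p w i) (p w (S i)) t -> Gamb w t <> RtoC 0 ->
     b <= Rabs (cos (line_angle (Gamb w t) (D w i t))))
  (hKbd : forall w z : C, W w -> on_curve (Gamb w) ta tb z -> z <> RtoC 0 ->
     Cmod (K w z) <= cw w * exp (- delta1 * Cmod z) * / Cmod z ^ k0)
  (hfbd : forall w gamma z : C, W w -> U gamma ->
     on_curve (Gamb w) ta tb z -> z <> RtoC 0 ->
     Cmod (dilate gamma f z)
       <= ct gamma * exp (delta2 * Cmod z) * / Cmod (Cmult gamma z) ^ n0)
  (hrho : forall w : C, W w -> 0 < curve_dist0 (Gamb w) ta tb) :
  forall n : Z, (- Z.of_nat n0 <= n < Z.of_nat k0 - 1)%Z ->
  forall w gamma : C, W w -> U gamma -> Cmod gamma < r ->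
    (* the printed bound, which is false for small c < 1 *)
    (1 <= c ->
     Cmod (Cminus (transform K Gam ta tb f gamma w)
                  (truncated K Gam ta tb n0 a n gamma w))
       <= Cbar d n0 k0 a b c n r (curve_dist0 (Gamb w) ta tb)
          * cw w * ct gamma * powerRZ (Cmod gamma) (n + 1)
          * / (delta1 - delta2)) /\
    (* the bound for every c *)
    Cmod (Cminus (transform K Gam ta tb f gamma w)
                 (truncated K Gam ta tb n0 a n gamma w))
      <= Cbar d n0 k0 a b c n r (curve_dist0 (Gamb w) ta tb)
         * cw w * (ct gamma / c) * powerRZ (Cmod gamma) (n + 1)
         * / (delta1 - delta2).
Proof.
  intros n Hn w gamma Hw Hgamma Hgr.
  set (rho := curve_dist0 (Gamb w) ta tb).
  assert (Hg0 : gamma <> RtoC 0) by (intros ->; contradiction).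
  assert (Pg := proj1 (Cmod_gt_0 gamma) Hg0).
  assert (Hkap := kappa_pos f n0 a ha r hr hrf).
  assert (Hct := hct gamma Hgamma); assert (Hcw := hcw w Hw).
  assert (Hrho := hrho w Hw); fold rho in Hrho.
  assert (PG := powerRZ_lt (Cmod gamma) (n + 1) Pg).
  assert (PCbar := Cbar_nonneg d n0 k0 a b c n r rho hb hc hr Hkap).
  enough (Main : Cmod (Cminus (transform K Gam ta tb f gamma w)
                         (truncated K Gam ta tb n0 a n gamma w))
      <= Cbar d n0 k0 a b c n r rho * cw w * (ct gamma / c) * powerRZ (Cmod gamma) (n + 1)
         * / (delta1 - delta2)).
  (* When [1 <= c], replacing [ct gamma / c] by [ct gamma] only enlarges the bound. *)
  { split; [|exact Main]; intros Hc1; eapply Rle_trans; [exact Main|].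
    apply Rmult_le_compat_r; [left; now apply Rinv_0_lt_compat|].
    apply Rmult_le_compat_r; [lra|].
    apply Rmult_le_compat_l; [now apply Rmult_le_pos|].
    apply Rle_div_l; nra. }
  set (Om := fun z => ~ is_pole (K w) z /\ ~ is_pole (dilate gamma f) z).
  destruct (hdef w gamma Hw Hgamma Hgr) as (H & Hdef & Hneg); fold Om in Hdef.
  (* [- n0 <= n < k0 - 1] forces [k0 > 0] or [n0 > 0]. *)
  assert (Om0 : forall z, Om z -> z <> RtoC 0).
  { intros z [HzK Hzf] ->; destruct k0 as [|k0'].
    - apply Hzf; exists n0; split; [lia|]; apply pole_order_dilate; [exact Hg0|].
      replace (gamma * 0)%C with (RtoC 0) by ring; exact hn0.
    - apply HzK; exists (S k0'); split; [lia | now apply hk0]. }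
  assert (HolK : forall z, Om z -> holo_near (K w) z)
    by (intros z [Hz _]; apply meromorphic_not_pole; auto).
  assert (Arcs0 : piecewise_arcs (Gam w) ta tb) by now apply piecewise_C1_arcs, hGs.
  assert (Arcs1 : piecewise_arcs (Gamb w) ta tb)
    by (eapply arc_decomposition_arcs, (proj1 (harcs w Hw))).
  assert (IF := contour_int_correct _ _ _ _ (hA w gamma Hw Hgamma)).
  apply (contour_deformation Om (fun z => K w z * dilate gamma f z)%C ta tb (Gam w) (Gamb w) H) in IF;
    try assumption.
  2: { intros z Hz; apply holo_near_mult; [now apply HolK | apply dilate_not_pole; auto; apply Hz]. }
  2: { intros e He; exact (proj1 (Hneg e He)). }
  fold (transform K Gam ta tb f gamma w) in IF.
  set (N := Z.to_nat (n + Z.of_nat n0)).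
  (* For [k <= N] the exponent [idx n0 k] runs from [- n0] to [n], within the range where the ends
     are assumed negligible. *)
  assert (IM : forall k, (k <= N)%nat -> is_RInt_gen (V := C_R_NormedModule)
    (fun t => (a (idx n0 k) * Cpowz gamma (idx n0 k)) *
       (K w (Gamb w t) * Cpowz (Gamb w t) (idx n0 k) * velocity (Gamb w) t))%C
    (end_filter ta) (end_filter tb)
    (a (idx n0 k) * Cpowz gamma (idx n0 k) * moment K Gam ta tb (idx n0 k) w)%C).
  { intros k Hk; apply is_RInt_gen_Cmult; [apply end_filter_proper ..|].
    assert (I := contour_int_correct _ _ _ _ (hh (idx n0 k) w Hw)).
    apply (contour_deformation Om (fun z => K w z * Cpowz z (idx n0 k))%C
      ta tb (Gam w) (Gamb w) H) in I; try assumption.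
    - intros z Hz; apply holo_near_mult; [now apply HolK | now apply holo_near_Cpowz, Om0].
    - intros e He; apply (proj2 (Hneg e He)); unfold idx, N in *; lia. }
  assert (IS := is_RInt_gen_sum_n _ _ _ _ _ IM).
  (* Subtraction precedes any estimate: the power [n + 1] of [gamma] comes from comparing [f] with
     its partial sum under one integral. *)
  assert (I := is_RInt_gen_minus (V := C_R_NormedModule) _ _ _ _ IF IS).
  replace (truncated K Gam ta tb n0 a n gamma w)
    with (sum_n (G := C_AbelianMonoid) (fun k =>
      a (idx n0 k) * Cpowz gamma (idx n0 k) * moment K Gam ta tb (idx n0 k) w)%C N).
  2: { apply sum_n_ext; intros k; match goal with |- @eq _ ?x ?y => change (@eq C x y) end; ring. }
  set (M := cw w * powerRZ (Cmod gamma / r) (n + 1) *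
      (ct gamma * powerRZ r (- Z.of_nat n0)
       + Rmax (powerRZ r (- Z.of_nat n0)) (powerRZ rho (n - Z.of_nat k0 + 1)) * kappa n0 a r)).
  assert (P0 := powerRZ_lt r (- Z.of_nat n0) hr); assert (P1 := powerRZ_lt r (n + 1) hr).
  assert (PM := Rmax_l (powerRZ r (- Z.of_nat n0)) (powerRZ rho (n - Z.of_nat k0 + 1))).
  set (Mx := Rmax (powerRZ r (- Z.of_nat n0)) (powerRZ rho (n - Z.of_nat k0 + 1))) in *.
  assert (HMk : 0 <= Mx * kappa n0 a r) by (apply Rmult_le_pos; lra).
  assert (HM : 0 <= M).
  { unfold M; apply Rmult_le_pos; [apply Rmult_le_pos; [exact Hcw|]|nra].
    left; apply powerRZ_lt, Rdiv_lt_0_compat; lra. }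
  assert (Dist : forall t, in_dom ta tb t -> rho <= Cmod (Gamb w t))
    by (intros t Ht; apply curve_dist0_le; now exists t).
  assert (NZ : forall t, in_dom ta tb t -> Gamb w t <> RtoC 0)
    by (intros t Ht; apply Cmod_gt_0; specialize (Dist t Ht); lra).
  apply Rle_trans with (INR d * (M / (b * (delta1 - delta2)))).
  - apply (is_RInt_gen_Cmod_le _ ta tb) with (3 := I); [exact htab|].
    intros u v y Hu Hv Huv Hy.
    apply (curve_estimate (Gamb w) ta tb d (p w) (D w)
      (fun t => K w (Gamb w t) * (dilate gamma f (Gamb w t) - partial n0 a (gamma * Gamb w t) N))%C
      u v b (delta1 - delta2) M y); auto.
    + intros i t Hi Ht; apply hangle; auto.
      apply NZ; destruct (harcs w Hw) as ((Hp0 & Hpd & Ha) & _).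
      assert (Mono := breakpoints_monotone (p w) d (fun i Hi => proj1 (Ha i Hi))).
      destruct Ht as [A1 A2]; split.
      * rewrite <- Hp0; eapply Rbar_le_trans; [|exact A1]; apply Mono; lia.
      * rewrite <- Hpd; eapply Rbar_le_trans; [exact A2|]; apply Mono; lia.
    + intros t Ht; assert (Nt := NZ t Ht).
      assert (Ng : (gamma * Gamb w t)%C <> RtoC 0) by now apply Cmult_neq_0.
      apply (integrand_bound n0 k0 n _ _ _ gamma); auto; try lra.
      * apply hKbd; auto; now exists t.
      * apply (hfbd w gamma); auto; now exists t.
      * intros Hle; apply (laurent_remainder f n0 a ha r); auto; lia.
      * intros Hle; apply (laurent_partial_bound f n0 a ha r); auto; lia.
    + eapply (is_RInt_ext (V := C_R_NormedModule)); [|exact Hy].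
      rewrite Rmin_left, Rmax_right by lra; intros t Ht.
      assert (Dt : in_dom ta tb t).
      { split.
        - apply Rbar_le_trans with (Finite u); [apply Hu | simpl; lra].
        - apply Rbar_le_trans with (Finite v); [simpl; lra | apply Hv]. }
      unfold partial.
      (* The powers of [gamma] and of the curve point merge into one power of their product, making
         the sum a Laurent partial sum of [f] at the dilated point. *)
      rewrite (sum_n_ext (G := C_AbelianMonoid) _
        (fun k => (K w (Gamb w t) * velocity (Gamb w) t) * term n0 a (gamma * Gamb w t) k)%C).
      * rewrite sum_n_Cmult.
        match goal with |- minus ?x ?y = ?z => change (@eq C (x - y)%C z) end; ring.
      * intros k; unfold term; rewrite Cpowz_mult by auto.
        match goal with |- @eq _ ?x ?y => change (@eq C x y) end; ring.
  - unfold Cbar; fold Mx.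
    replace (INR d * (M / (b * (delta1 - delta2)))) with
      ((INR d * (ct gamma * powerRZ r (- Z.of_nat n0) + Mx * kappa n0 a r)) *
       (cw w * powerRZ (Cmod gamma) (n + 1) / (b * powerRZ r (n + 1) * (delta1 - delta2))))
      by (unfold M; fold Mx; rewrite powerRZ_div; field; lra).
    replace ((INR d * c * powerRZ r (- Z.of_nat n0) + INR d * Mx * kappa n0 a r)
        / (b * powerRZ r (n + 1)) * cw w * (ct gamma / c) * powerRZ (Cmod gamma) (n + 1)
        * / (delta1 - delta2)) with
      ((INR d * (ct gamma * powerRZ r (- Z.of_nat n0) + ct gamma / c * (Mx * kappa n0 a r))) *
       (cw w * powerRZ (Cmod gamma) (n + 1) / (b * powerRZ r (n + 1) * (delta1 - delta2))))
      by (field; lra).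
    apply Rmult_le_compat_r.
    + apply Rdiv_le_0_compat; [nra|]; apply Rmult_lt_0_compat; [nra | exact hdelta].
    (* The [kappa] term lacks a factor [ct gamma]; the lower bound [c <= ct gamma] allows
       [ct gamma / c] to be inserted. *)
    + apply Rmult_le_compat_l; [apply pos_INR|]; apply Rplus_le_compat_l.
      assert (1 <= ct gamma / c) by (apply Rle_div_r; lra); nra.
Qed.
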